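(* Let $H_{\mathbb{R}}$ be a finite dimensional real Hilbert space with complexification $H$, let $q\in(-1,1)$ and $1\le p\le\infty$, and let $(\Phi_t)_{t\ge0}$ be the Ornstein-Uhlenbeck quantum Markov semi-group on the $q$-Gaussian algebra $\Gamma_q(H_{\mathbb{R}})$. If $|q|<\dim(H)^{-1/p}$, then $(\Phi_t)_{t\ge0}$ is gradient-$\mathcal{S}_p$. If $|q|\le\dim(H)^{-1/p}$, then $(\Phi_t)_{t\ge0}$ is immediately gradient-$\mathcal{S}_p$. (Both notions are with respect to the $\ast$-subalgebra $\mathcal{A}_q$.)
   Context: $q$-Gaussian algebras. $H=H_{\mathbb{R}}\otimes\mathbb{C}$. For $q\in(-1,1)$ let $P_q^n$ on $H^{\otimes n}$ be $P_q^n(\xi_1\otimes\dots\otimes\xi_n)=\sum_{\sigma\in S_n}q^{i(\sigma)}\xi_{\sigma(1)}\otimes\dots\otimes\xi_{\sigma(n)}$, with $i(\sigma)$ the number of inversions of $\sigma$. $H_q^{\otimes n}$ is $H^{\otimes n}$ with the inner product $\langle\xi,\eta\rangle_q=\langle P_q^n\xi,\eta\rangle$. The $q$-Fock space is $F_q(H)=\mathbb{C}\Omega\oplus\bigoplus_{n\ge1}H_q^{\otimes n}$ with $\Omega$ a unit vector. For $\xi\in H$ the bounded operator $l_q(\xi)$ on $F_q(H)$ is $l_q(\xi)(\eta_1\otimes\dots\otimes\eta_n)=\xi\otimes\eta_1\otimes\dots\otimes\eta_n$, $l_q(\xi)\Omega=\xi$. $\mathcal{A}_q$ is the unital $\ast$-algebra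 generated by $l_q(\xi)+l_q(\xi)^\ast$, $\xi\in H_{\mathbb{R}}$, and $\Gamma_q=\Gamma_q(H_{\mathbb{R}})=\mathcal{A}_q''$. The vacuum state $x\mapsto\langle x\Omega,\Omega\rangle$ is a faithful normal trace on $\Gamma_q$ and $L_2(\Gamma_q)=F_q(H)$ with cyclic vector $\Omega$. For $\xi_1,\dots,\xi_n\in H$ there is a unique $W_q(\xi_1\otimes\dots\otimes\xi_n)\in\Gamma_q$ with $W_q(\xi_1\otimes\dots\otimes\xi_n)\Omega=\xi_1\otimes\dots\otimes\xi_n$; these operators (with $1=W_q(\Omega)$) lie in $\mathcal{A}_q$ and span it. The Ornstein-Uhlenbeck semi-group $(\Phi_t)_{t\ge0}$ is the semi-group of trace preserving normal unital completely positive maps on $\Gamma_q$ determined by $\Phi_t(W_q(\xi_1\otimes\dots\otimes\xi_n))=e^{-tn}W_q(\xi_1\otimes\dots\otimes\xi_n)$. Its generator $\Delta$ on $F_q(H)$ is the number operator, $\Delta(\xi_1\otimes\dots\otimes\xi_n)=n\,\xi_1\otimes\dots\otimes\xi_n$; correspondingly $\Delta(W_q(\xi_1\otimes\dots\otimes\xi_n))=n\,W_q(\xi_1\otimes\dots\otimes\xi_n)$ on $\mathcal{A}_q$. Gradient-$\mathcal{S}_p$. $\mathcal{S}_p$ is the Schatten-von Neumann class (the non-commutative $L_p$-space of $B(L_2)$ with its trace); for $p=\infty$, $\dim(H)^{-1/p}=1$. For $a,b\in\mathcal{A}_q$ and $t\ge0$ put $\Psi_t^{a,b}(x)=-\frac12\Phi_t\big(\Delta(axb)+a\Delta(x)b-\Delta(ax)b-a\Delta(xb)\big)$,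 $x\in\mathcal{A}_q$. The semi-group is gradient-$\mathcal{S}_p$ if for all $a,b\in\mathcal{A}_q$ the map $x\Omega\mapsto\Psi_0^{a,b}(x)\Omega$ extends to a bounded operator on $F_q(H)$ lying in $\mathcal{S}_p$. It is immediately gradient-$\mathcal{S}_p$ if for all $a,b\in\mathcal{A}_q$ and every $t>0$ the map $x\Omega\mapsto\Psi_t^{a,b}(x)\Omega$ extends to a bounded operator on $F_q(H)$ lying in $\mathcal{S}_p$. *)

(* Defs.v *)
From HB Require Import structures.
From mathcomp Require Import all_boot all_order all_fingroup all_algebra.
From mathcomp Require Export complex.
From mathcomp Require Import all_classical all_reals all_analysis.

Set Implicit Arguments.
Unset Strict Implicit.
Unset Printing Implicit Defensive.

Import Order.TTheory GRing.Theory Num.Theory.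
Import numFieldNormedType.Exports.

Local Open Scope classical_set_scope.
Local Open Scope ring_scope.
Local Open Scope complex_scope.

Section Fock.
Variables (R : realType) (d : nat) (q : R).

(* Coordinates with respect to an orthonormal basis (e_i) of H, dim H = d.  The
   word w = [:: i_1; ...; i_n] stands for e_{i_1} (x) ... (x) e_{i_n}, the empty
   word for Omega.  A vector is its family of coordinates, and its component in
   H^{(x) n} is its restriction to the words of length n.  A general element of
   [vec] is a formal, possibly divergent, sum; membership in F_q(H) is the
   predicate [fock] below. *)
Definition vec : Type := seq 'I_d -> R[i]^o.
HB.instance Definition _ := GRing.Lmodule.on vec.

Definition inversions n (s : 'S_n) : nat :=
  #|[set k : 'I_n * 'I_n | (k.1 < k.2)%N && (s k.2 < s k.1)%N]|.

Definition permute n (s : 'S_n) (w : n.-tuple 'I_d) : n.-tuple 'I_d :=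
  [tuple tnth w (s k) | k < n].

Definition Pq n (x : vec) (w : n.-tuple 'I_d) : R[i] :=
  \sum_(v : n.-tuple 'I_d) \sum_(s : 'S_n)
     x v * (q ^+ inversions s)%:C * (permute s v == w)%:R.

Definition ipq n (x y : vec) : R[i] :=
  \sum_(w : n.-tuple 'I_d) Pq x w * (y w)^*.

(* F_q(H), the Hilbert space direct sum of the H_q^{(x) n}.  The inner product
   <.,.>_q is positive definite for -1 < q < 1, so no quotient is taken. *)
Definition fock : set vec :=
  [set x | cvgn (series (fun n => complex.Re (ipq n x x)))].

Definition fip (x y : vec) : R[i] :=
  limn (series (fun n => complex.Re (ipq n x y)))
  +i* limn (series (fun n => complex.Im (ipq n x y))).

Definition fnorm (x : vec) : R :=
  Num.sqrt (limn (series (fun n => complex.Re (ipq n x x)))).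

Definition vacuum : vec := fun w => (w == [::])%:R.

(* Only the values on [fock] of an operator are meaningful: two operators that
   agree on [fock] are the same element of B(F_q(H)). *)
Definition oper : Type := vec -> vec.
HB.instance Definition _ := GRing.Lmodule.on oper.

Definition bounded_op (T : oper) : Prop :=
  [/\ forall x, fock x -> fock (T x),
      forall (c : R[i]) x y, fock x -> fock y -> T (c *: x + y) = c *: T x + T y
    & exists M : R, forall x, fock x -> fnorm (T x) <= M * fnorm x].

Definition is_adjoint (T S : oper) : Prop :=
  forall x y, fock x -> fock y -> fip (T x) y = fip x (S y).

(* l_q(xi), for the vector xi of H with coordinates xi i *)
Definition creation (xi : 'I_d -> R[i]) : oper :=
  fun x w => if w is i :: w' then xi i * x w' else 0.

Definition commutant (A : set oper) : set oper :=
  [set T | bounded_op T /\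
           forall S, A S -> forall x, fock x -> T (S x) = S (T x)].

(* Schmidt expansion T = sum_n s_n <., u_n> v_n with singular values s_n; the
   orthonormality is required only where s_n != 0, so that operators of finite
   rank (in particular when F_q(H) has finite dimension) are covered. *)
Definition schmidt (T : oper) (s : nat -> R) (u v : nat -> vec) : Prop :=
  [/\ forall n, 0 <= s n,
      forall n, fock (u n) /\ fock (v n),
      forall m n, s m != 0 -> s n != 0 ->
        fip (u m) (u n) = (m == n)%:R /\ fip (v m) (v n) = (m == n)%:R
    & forall x, fock x ->
        (fun N : nat => fnorm (T x - \sum_(n < N) ((s n)%:C * fip x (u n)) *: v n))
          @ \oo --> (0 : R)].

(* The Schatten-von Neumann class S_p(F_q(H)): compact operators whose sequence
   of singular values is in l_p (p < oo), all compact operators (p = oo). *)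
Definition schatten (p : \bar R) (T : oper) : Prop :=
  bounded_op T /\
  exists s u v, schmidt T s u v /\
    match p with
    | r%:E => cvgn (series (fun n => s n `^ r))
    | +oo%E => s @ \oo --> (0 : R)
    | -oo%E => False
    end.

Definition numberop : oper := fun x w => (size w)%:R * x w.

Definition ou_fock (t : R) : oper :=
  fun x w => (expR (- t * (size w)%:R))%:C * x w.

End Fock.

(* H_R is a real vector space of finite dimension with inner product ip, and e
   an orthonormal basis of it, used as the basis of H = H_R (x) C above. *)
Section QGaussian.
Variables (R : realType) (HR : vectType R) (ip : {dot HR for idfun}).
Variables (e : 'I_(\dim {:HR}) -> HR) (q : R).

Definition orthonormal_basis : Prop := forall i j, ip (e i) (e j) = (i == j)%:R.

Local Notation d := (\dim {:HR}).
Local Notation operator := (oper R d).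
Local Notation Omega := (@vacuum R d).

Definition complexify (xi : HR) : 'I_d -> R[i] := fun i => (ip xi (e i))%:C.

Inductive Aq : operator -> Prop :=
| Aq_gen (xi : HR) (l' : operator) :
    bounded_op q l' -> is_adjoint q (creation (complexify xi)) l' ->
    Aq (creation (complexify xi) + l')
| Aq_one : Aq id
| Aq_add a b : Aq a -> Aq b -> Aq (a + b)
| Aq_scale (c : R[i]) a : Aq a -> Aq (c *: a)
| Aq_mul a b : Aq a -> Aq b -> Aq (a \o b)
| Aq_star a a' : Aq a -> bounded_op q a' -> is_adjoint q a a' -> Aq a'.

Definition Gammaq : set operator := commutant q (commutant q Aq).

(* The element of Gamma_q that maps Omega to x; it is unique as an operator on
   [fock] because Omega is separating, and exists for x in A_q Omega. *)
Definition Wq (x : vec R d) : operator :=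
  xget 0 [set T | Gammaq T /\ T Omega = x].

(* Phi_t(W_q(xi_1 (x) ... (x) xi_n)) = e^{-tn} W_q(xi_1 (x) ... (x) xi_n) *)
Definition Phi (t : R) (x : operator) : operator := Wq (ou_fock t (x Omega)).

(* Delta(W_q(xi_1 (x) ... (x) xi_n)) = n W_q(xi_1 (x) ... (x) xi_n) *)
Definition Delta (x : operator) : operator := Wq (numberop (x Omega)).

Definition Psi (t : R) (a b x : operator) : operator :=
  (- 2^-1 : R[i]) *:
    Phi t (Delta (a \o x \o b) + (a \o Delta x \o b)
           - (Delta (a \o x) \o b) - (a \o Delta (x \o b))).

Definition extends_in_schatten (p : \bar R) (F : operator -> operator) : Prop :=
  exists T : operator, schatten q p T /\
    forall x, Aq x -> T (x Omega) = F x Omega.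

Definition gradient_S (p : \bar R) : Prop :=
  forall a b, Aq a -> Aq b -> extends_in_schatten p (Psi 0 a b).

Definition immediately_gradient_S (p : \bar R) : Prop :=
  forall a b, Aq a -> Aq b -> forall t, 0 < t ->
    extends_in_schatten p (Psi t a b).

(* dim(H)^{-1/p}; the inverses are those of \bar R, so it is 1 for p = +oo, and
   +oo for p < +oo and dim H = 0. *)
Definition dim_root (p : \bar R) : \bar R :=
  ((d%:R `^ fine (p^-1)%E)%:E^-1)%E.

End QGaussian.

(* Main.v *)
(* Let A be left multiplication by a and B right multiplication by b.  On finite
   vectors Psi_0^{a,b} is -1/2 [[N, A], B], N being the number operator.  For
   generators, A = l(xi) + l(xi)^* and B = r(eta) + r(eta)^*, and the only
   nonzero commutators [l^*, r] and [l, r^*] are multiples of q^N, hence so is the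
   double commutator.  Since A and B commute, [[N, A], B] satisfies the Leibniz
   rule in A and in B; so for all a and b it is a sum of terms X q^N Y, with X and
   Y bounded operators that shift the degree by a bounded amount.

   Hence e^{-tN} [[N, A], B] has norm O(rho^M) on the vectors of degree at least M,
   for every rho >= |q| e^{-t}, rho > 0.  These vectors form a subspace of
   codimension at most 1 + d + ... + d^(M-1), so a dimension count bounds the
   singular values of index at least that number by O(rho^M); they are
   p-summable as soon as d rho^p < 1.  The Schmidt expansion itself is obtained by
   successively maximizing |T x| over the unit ball, which is weakly compact.

   Positivity of the q-inner product: the number of inversions of r t^-1 is the
   size of the symmetric difference of the inversion sets of r^-1 and t^-1, so
   q^i is a restriction of a tensor power of the positive definite 2 x 2 matrix
   [[1, q], [q, 1]].  Boundedness of l(xi) follows from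
   l(xi)^* l(xi) = |xi|^2 + q l(xi) l(xi)^* by induction on the degree. *)
Require Import Defs.
From HB Require Import structures.
From mathcomp Require Import all_boot all_order all_fingroup all_algebra.
From mathcomp Require Import all_classical all_reals all_analysis.
From mathcomp Require Import zify ring lra.

Set Implicit Arguments.
Unset Strict Implicit.
Unset Printing Implicit Defensive.

Import Order.TTheory GRing.Theory Num.Theory.
Import numFieldNormedType.Exports.

Local Open Scope classical_set_scope.
Local Open Scope complex_scope.
Local Open Scope ring_scope.

(** * Singular values in an inner product space *)

(** Membership in the Schatten class is expressed by Schmidt expansions, a form that behaves badly
    under sums and products. What is propagated through the Leibniz rule is therefore not this
    membership but the decay of $\|Tx\|$ on vectors of high degree, which survives sums and
    composition with bounded operators of limited degree shift. Singular values are extracted only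
    once, from the final operator. Composition on the right with an operator lowering the degree by
    up to $K$ costs a factor $\rho^{-K}$; this is why $\rho>0$ is kept even for $q=0$.

    Operators are functions on all formal vectors but are determined on [fock] only. Elements of
    [Aq] are replaced by polynomials in the field operators: these agree with them on [fock], and
    their commutation relations are identities between formal vectors, to which the unbounded number
    operator applies as well. The operators [Wq], chosen in the bicommutant, are identified through
    polynomials in the right field operators, which lie in the commutant of [Aq] and map the vacuum
    onto all finite vectors. *)

Lemma conjC_real (R : rcfType) (t : R) : (t%:C)^* = t%:C.
Proof. exact: conjc_real. Qed.

Lemma real_complexD (R : rcfType) (a b : R) : (a + b)%:C = a%:C + b%:C.
Proof. exact: rmorphD. Qed.

Lemma real_complexM (R : rcfType) (a b : R) : (a * b)%:C = a%:C * b%:C.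
Proof. exact: rmorphM. Qed.

Lemma real_complexX (R : rcfType) (a : R) n : (a ^+ n)%:C = a%:C ^+ n.
Proof. exact: rmorphXn. Qed.

Section Hilbert.
Variables (R : realType) (V : lmodType R[i]) (B : V -> V -> R[i]).
Hypothesis BD : forall (c : R[i]) x y z, B (c *: x + y) z = c * B x z + B y z.
Hypothesis BC : forall x y, B y x = (B x y)^*.
Hypothesis B0 : forall x, 0 <= B x x.
Hypothesis Bdef : forall x, B x x = 0 -> x = 0.

Definition hn (x : V) : R := Num.sqrt (complex.Re (B x x)).

Lemma form0l y : B 0 y = 0.
Proof. by have := BD (-1) 0 0 y; rewrite scaler0 addr0 mulN1r addNr. Qed.
Lemma formDl x y z : B (x + y) z = B x z + B y z.
Proof. by rewrite -[x]scale1r BD mul1r scale1r. Qed.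
Lemma formZl c x z : B (c *: x) z = c * B x z.
Proof. by rewrite -[c *: x]addr0 BD form0l addr0. Qed.
Lemma formBl x y z : B (x - y) z = B x z - B y z.
Proof. by rewrite formDl -scaleN1r formZl mulN1r. Qed.
Lemma form0r y : B y 0 = 0. Proof. by rewrite BC form0l rmorph0. Qed.
Lemma formDr x y z : B z (x + y) = B z x + B z y.
Proof. by rewrite BC formDl rmorphD /= -!BC. Qed.
Lemma formZr c x z : B z (c *: x) = c^* * B z x.
Proof. by rewrite BC formZl rmorphM /= -BC. Qed.
Lemma formBr x y z : B z (x - y) = B z x - B z y.
Proof. by rewrite BC formBl rmorphB /= -!BC. Qed.
Lemma form_suml (I : Type) (r : seq I) (P : pred I) (F : I -> V) z :
  B (\sum_(i <- r | P i) F i) z = \sum_(i <- r | P i) B (F i) z.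
Proof.
exact: (big_morph (fun x => B x z) (fun x y => formDl x y z) (form0l z)).
Qed.
Lemma form_sumr (I : Type) (r : seq I) (P : pred I) (F : I -> V) z :
  B z (\sum_(i <- r | P i) F i) = \sum_(i <- r | P i) B z (F i).
Proof.
exact: (big_morph (B z) (fun x y => formDr x y z) (form0r z)).
Qed.

Lemma form_hn x : B x x = (hn x ^+ 2)%:C.
Proof.
have := B0 x; rewrite /hn lecE /= => /andP[/eqP h0 h1].
by rewrite sqr_sqrtr //; case: (B x x) h0 h1 => a b /= ->.
Qed.

Lemma hn_ge0 x : 0 <= hn x. Proof. exact: sqrtr_ge0. Qed.
Lemma hn0 : hn 0 = 0.
Proof. by rewrite /hn form0l sqrtr0. Qed.
Lemma hn_eq0 x : hn x = 0 -> x = 0.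
Proof. by move=> h; apply: Bdef; rewrite form_hn h expr0n. Qed.

Lemma hnZ c x : (hn (c *: x))%:C = `|c| * (hn x)%:C.
Proof.
apply/eqP; rewrite -(eqrXn2 (_ : 0 < 2)%N) //; last 2 first.
- by rewrite ler0c hn_ge0.
- by rewrite mulr_ge0 // ler0c hn_ge0.
have E z : (hn z)%:C ^+ 2 = B z z by rewrite form_hn rmorphXn.
by rewrite exprMn !E formZl formZr mulrA normCK.
Qed.

Lemma hnZR (r : R) x : 0 <= r -> hn (r%:C *: x) = r * hn x.
Proof.
move=> r0; apply: (@complexI R); rewrite hnZ rmorphM ger0_norm //.
by rewrite ler0c.
Qed.

Lemma pythagoras x y : B x y = 0 -> hn (x + y) ^+ 2 = hn x ^+ 2 + hn y ^+ 2.
Proof.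
move=> h; apply: (@complexI R); rewrite rmorphD /= -!form_hn formDl !formDr.
by rewrite (BC x y) h rmorph0 addr0 add0r.
Qed.

Lemma cauchy_schwarz x y : `|B x y| <= (hn x * hn y)%:C.
Proof.
have [y0|y0] := eqVneq (hn y) 0.
  by rewrite (hn_eq0 y0) form0r normr0 hn0 mulr0.
have b0 : 0 < B y y by rewrite form_hn ltcR exprn_gt0 // lt_def y0 hn_ge0.
have := B0 (B y y *: x - B x y *: y).
have -> : B (B y y *: x - B x y *: y) (B y y *: x - B x y *: y)
    = B y y * (B y y * B x x - `|B x y| ^+ 2).
  rewrite formBl !formBr !formZl !formZr -!BC [B y x]BC normCK; ring.
rewrite pmulr_rge0 // subr_ge0 !form_hn -rmorphM -exprMn rmorphXn /=.
by rewrite [hn y * hn x]mulrC ler_sqr // nnegrE ler0c mulr_ge0 ?hn_ge0.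
Qed.

Lemma cauchy_schwarz_Re x y : complex.Re (B x y) <= hn x * hn y.
Proof.
rewrite -lecR; apply: le_trans (cauchy_schwarz x y).
apply: le_trans (normc_ge_Re _); rewrite lecR; exact: ler_norm.
Qed.

Lemma hnD x y : hn (x + y) <= hn x + hn y.
Proof.
rewrite -ler_sqr ?nnegrE ?addr_ge0 ?hn_ge0 //.
have -> : hn (x + y) ^+ 2
    = hn x ^+ 2 + 2 * complex.Re (B x y) + hn y ^+ 2.
  have : B (x + y) (x + y) = B x x + (B x y + (B x y)^*) + B y y.
    by rewrite formDl !formDr [B y x]BC; ring.
  rewrite !form_hn; case: (B x y) => a b [-> _] /=; ring.
by have := cauchy_schwarz_Re x y; nra.
Qed.

Lemma form_sum_orthogonal (n : nat) (c : 'I_n -> R[i]) (u : nat -> V) :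
  (forall i j, (i < n)%N -> (j < i)%N -> B (u i) (u j) = 0) ->
  B (\sum_(i < n) c i *: u i) (\sum_(i < n) c i *: u i)
  = \sum_(i < n) `|c i| ^+ 2 * B (u i) (u i).
Proof.
move=> h; rewrite form_suml; apply: eq_bigr => i _.
rewrite form_sumr (bigD1 i) //= big1 => [|j ji].
  by rewrite addr0 formZl formZr mulrA normCK.
rewrite formZl formZr; have [ij|ij|/ord_inj ij] := ltngtP i j.
- by rewrite BC h // rmorph0 !mulr0.
- by rewrite h // !mulr0.
- by rewrite ij eqxx in ji.
Qed.

Section SingularValues.
Variable T : {linear V -> V}.
(** Compactness of [T] enters this section only through the attainment of these maxima. *)
Hypothesis maxT : forall us : seq V, exists x,
  [/\ hn x <= 1, forall u, u \in us -> B x u = 0 &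
      forall y, hn y <= 1 -> (forall u, u \in us -> B y u = 0) ->
        hn (T y) <= hn (T x)].

(** Homogeneity turns a maximum over the ball into a bound on the whole orthogonal complement of
    [us], and forces norm 1 on a maximizer with nonzero image. If [T] vanishes on the complement,
    the vector 0 is taken; so the construction goes on forever, even in finite dimension. *)
Lemma unit_maximizer (us : seq V) : exists x,
  [/\ x = 0 \/ hn x = 1, forall u, u \in us -> B x u = 0 &
      forall y, (forall u, u \in us -> B y u = 0) ->
        hn (T y) <= hn (T x) * hn y].
Proof.
have [x [x1 xp xm]] := maxT us.
have {}xm y : (forall u, u \in us -> B y u = 0) -> hn (T y) <= hn (T x) * hn y.
  move=> yp; have [y0|y0] := eqVneq (hn y) 0.
    by rewrite (hn_eq0 y0) linear0 hn0 mulr0.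
  have py : 0 < hn y by rewrite lt_def y0 hn_ge0.
  have iy : 0 <= (hn y)^-1 by rewrite invr_ge0 hn_ge0.
  have := xm ((hn y)^-1%:C *: y).
  rewrite linearZ /= !hnZR // mulVf // lexx => /(_ isT) h.
  rewrite mulrC -ler_pdivrMl //; apply: h => u /yp.
  by rewrite formZl => ->; rewrite mulr0.
have [Tx0|Tx0] := eqVneq (hn (T x)) 0.
  exists 0; split; [by left|by move=> u _; rewrite form0l|] => y /xm.
  by rewrite Tx0 linear0 hn0.
exists x; split => //; right; apply/eqP; rewrite eq_le x1 /=.
by have := xm _ xp; rewrite ler_pMr // lt_def Tx0 hn_ge0.
Qed.

Definition singular_vectors (u : nat -> V) := forall n,
  [/\ u n = 0 \/ hn (u n) = 1, forall j, (j < n)%N -> B (u n) (u j) = 0 &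
      forall y, (forall j, (j < n)%N -> B y (u j) = 0) ->
        hn (T y) <= hn (T (u n)) * hn y].

Lemma singular_vectors_exist : exists u, singular_vectors u.
Proof.
have [f fP] := choice unit_maximizer.
pose us n := iter n (fun s => rcons s (f s)) [::].
have usP n v : (v \in us n) <-> exists2 j, (j < n)%N & v = f (us j).
  elim: n => [|n IHn]; first by split=> // -[].
  rewrite /us iterS -/(us n) mem_rcons inE; split.
    case/orP=> [/eqP ->|/IHn[j jn ->]]; first by exists n.
    by exists j => //; rewrite ltnS ltnW.
  case=> j; rewrite ltnS leq_eqVlt => /orP[/eqP -> ->|jn vE].
    by rewrite eqxx.
  by apply/orP; right; apply/IHn; exists j.
exists (fun n => f (us n)) => n; have [h1 h2 h3] := fP (us n); split=> //.
  by move=> j jn; apply: h2; apply/usP; exists j.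
by move=> y yp; apply: h3 => u /usP[j jn ->]; exact: yp.
Qed.

Variable u : nat -> V.
Hypothesis uP : singular_vectors u.
Let s n := hn (T (u n)).

Lemma singular_hn_le1 n : hn (u n) <= 1.
Proof. by case: (uP n) => -[->|->] // _ _; rewrite hn0. Qed.

Lemma singular_orthogonal i j : i != j -> B (u i) (u j) = 0.
Proof.
rewrite neq_ltn => /orP[ij|ji]; last by case: (uP i) => _ /(_ _ ji).
by rewrite BC; case: (uP j) => _ /(_ _ ij) ->; rewrite rmorph0.
Qed.

Lemma singular_unit n : s n != 0 -> hn (u n) = 1.
Proof.
by case: (uP n) => -[un0|->] // _ _; rewrite /s un0 linear0 hn0 eqxx.
Qed.

(** For $i\le j$ the vector [u j] is admissible in the maximization that produced [u i]. *)
Lemma singular_nonincreasing i j : (i <= j)%N -> s j <= s i.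
Proof.
move=> ij; have [_ _ /(_ (u j)) h] := uP i.
apply: (le_trans (h _)) => [k ki|].
  by apply: singular_orthogonal; rewrite gtn_eqF // (leq_trans ki).
by rewrite ler_piMr ?hn_ge0 // singular_hn_le1.
Qed.

(* Perturbing the maximizer [u j] in the direction of [u n] has no first order
   effect on the norm of the image. *)
Lemma singular_image_orthogonal j n : (j < n)%N -> B (T (u n)) (T (u j)) = 0.
Proof.
move=> jn; have [uj _ ujm] := uP j.
have {uj}[->|uj1] := uj; first by rewrite linear0 form0r.
set b := B _ _; apply/eqP; apply: contraT => b0.
have [nb nbE] : exists nb : R, `|b| ^+ 2 = nb%:C.
  by exists (complex.Re b ^+ 2 + complex.Im b ^+ 2); rewrite add_Re2_Im2.
have nb0 : 0 < nb by rewrite -ltcR -nbE exprn_gt0 ?normr_gt0.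
have key (t : R) : 0 < t -> 2 * t * nb + t ^+ 2 * nb * hn (T (u n)) ^+ 2
    <= s j ^+ 2 * (t ^+ 2 * nb * hn (u n) ^+ 2).
  (* The phase of [c] is opposite to that of [b], so the first order term in [Tz2] is
     $2t|b|^2>0$. *)
  move=> t0; have [c cE] : exists c, c = t%:C * b^* by exists (t%:C * b^*).
  pose z := u j + c *: u n.
  have c2 : c * c^* = (t ^+ 2 * nb)%:C.
    rewrite real_complexM real_complexX -nbE normCK cE rmorphM /= conjCK.
    by rewrite conjC_real; ring.
  have zp k : (k < j)%N -> B z (u k) = 0.
    move=> kj; rewrite formDl formZl !singular_orthogonal ?mulr0 ?addr0 //.
      by rewrite gtn_eqF // (ltn_trans kj).
    by rewrite gtn_eqF.
  have z2 : hn z ^+ 2 = 1 + t ^+ 2 * nb * hn (u n) ^+ 2.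
    rewrite pythagoras ?uj1 ?expr1n; last first.
      by rewrite formZr singular_orthogonal ?mulr0 // ltn_eqF.
    congr (_ + _); apply: (@complexI R).
    by rewrite -form_hn formZl formZr mulrA c2 form_hn -real_complexM.
  have Tz2 : hn (T z) ^+ 2
      = s j ^+ 2 + 2 * t * nb + t ^+ 2 * nb * hn (T (u n)) ^+ 2.
    apply: (@complexI R); rewrite -form_hn linearD linearZ /=.
    rewrite formDl !formDr !formZl !formZr mulrA c2.
    rewrite [B (T (u j)) (T (u n))]BC -/b.
    have -> : c^* * b^* = (t * nb)%:C.
      by rewrite real_complexM -nbE normCK cE rmorphM /= conjCK conjC_real mulrA.
    have -> : c * b = (t * nb)%:C.
      by rewrite real_complexM -nbE normCK cE -mulrA [b^* * b]mulrC.
    by rewrite !form_hn /s !(real_complexM, real_complexD, real_complexX); ring.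
  have := ujm z zp; rewrite -ler_sqr ?nnegrE ?mulr_ge0 ?hn_ge0 // exprMn.
  by rewrite Tz2 z2 -/(s j) mulrDr mulr1 -addrA lerD2l.
pose M := s j ^+ 2 * hn (u n) ^+ 2.
have M0 : 0 <= M by rewrite mulr_ge0 ?sqr_ge0.
(* With this [t] one has $tM=1-t$, so the right side of [key] is $t(1-t)|b|^2$, less than the term
   $2t|b|^2$ on the left. *)
have t0 : 0 < (M + 1)^-1 by rewrite invr_gt0; lra.
have := key _ t0; set t := (M + 1)^-1 => {key}.
have -> : s j ^+ 2 * (t ^+ 2 * nb * hn (u n) ^+ 2) = t * nb * (t * M).
  by rewrite /M; ring.
have tM : t * M = 1 - t.
  by rewrite -[X in X - _](mulVf (_ : M + 1 != 0)) ?gt_eqF -/t //; [ring | lra].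
have : 0 <= t ^+ 2 * nb * hn (T (u n)) ^+ 2.
  by rewrite mulr_ge0 ?sqr_ge0 // mulr_ge0 ?sqr_ge0 // ltW.
have : 0 < t * nb by rewrite mulr_gt0.
have : 0 < t * nb * t by rewrite !mulr_gt0.
rewrite tM; nra.
Qed.

(** The remainder of [x] is orthogonal to the first [n] singular vectors, hence admissible at stage
    [n], and by Pythagoras it is no longer than [x]. *)
Lemma svd_remainder n x :
  hn (T (x - \sum_(j < n) B x (u j) *: u j)) <= s n * hn x.
Proof.
set p := \sum_(j < n) _.
have uu i : B (u i) (u i) = 0 /\ u i = 0 \/ B (u i) (u i) = 1.
  have [[->|h] _ _] := uP i; first by left; rewrite form0l.
  by right; rewrite form_hn h expr1n.
have yp i : (i < n)%N -> B (x - p) (u i) = 0.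
  move=> ni; rewrite formBl form_suml (bigD1 (Ordinal ni)) //= big1 => [|j ji].
    rewrite formZl addr0; case: (uu i) => -[]; last by move->; rewrite mulr1 subrr.
    by move=> _ ->; rewrite !form0r mulr0 subrr.
  by rewrite formZl singular_orthogonal ?mulr0.
have [_ _ /(_ _ yp) h] := uP n; apply: (le_trans h).
apply: ler_wpM2l; first exact: hn_ge0.
rewrite -ler_sqr ?nnegrE ?hn_ge0 //.
have : B (x - p) p = 0.
  by rewrite form_sumr big1 // => i _; rewrite formZr yp ?mulr0.
by move=> /pythagoras; rewrite subrK => ->; rewrite lerDl sqr_ge0.
Qed.

(** One half of the min-max principle: [D] linear conditions leave a nonzero [x] in the span of
    [u 0], ..., [u D]. The images of these vectors are orthogonal with norms at least [s D], so
    $\|Tx\|\ge s_D\|x\|$. *)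
Lemma singular_value_le (D : nat) (L : 'I_D -> {scalar V}) (C : R) : 0 <= C ->
  (forall x, (forall i, L i x = 0) -> hn (T x) <= C * hn x) -> s D <= C.
Proof.
(* When [s D] is nonzero, monotonicity makes all of [u 0], ..., [u D] unit vectors. *)
move=> C0 hL; have [->//|sD0] := eqVneq (s D) 0.
have sD : 0 < s D by rewrite lt_def sD0 hn_ge0.
pose A : 'M[R[i]]_(D.+1, D) := \matrix_(j, i) L i (u j).
have /rowV0Pn[v vA v0] : kermx A != 0.
  rewrite -mxrank_eq0 mxrank_ker subn_eq0 -ltnNge.
  by rewrite (leq_ltn_trans (rank_leq_col A)).
move: vA => /sub_kermxP vA.
pose x := \sum_(j < D.+1) v 0 j *: u j.
have unit_u (j : 'I_D.+1) : B (u j) (u j) = 1.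
  rewrite form_hn singular_unit ?expr1n // gt_eqF // (lt_le_trans sD) //.
  by apply: singular_nonincreasing; rewrite -ltnS.
have Lx i : L i x = 0.
  move/matrixP/(_ 0 i): vA; rewrite !mxE => <-; rewrite /x linear_sum.
  by apply: eq_bigr => j _; rewrite linearZ mxE.
pose S := \sum_(j < D.+1) `|v 0 j| ^+ 2.
have S0 : 0 < S.
  rewrite lt_def sumr_ge0 ?andbT => [|j _]; last by rewrite exprn_ge0.
  apply: contra v0 => /eqP/psumr_eq0P S0.
  apply/eqP/rowP => j; rewrite mxE; apply/eqP.
  rewrite -normr_eq0 -sqrf_eq0 S0 // => k _; exact: exprn_ge0.
have xx : B x x = S.
  rewrite form_sum_orthogonal => [|i j _ ji].
    by apply: eq_bigr => j _; rewrite unit_u mulr1.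
  by rewrite singular_orthogonal // gtn_eqF.
have TT : (s D ^+ 2)%:C * S <= B (T x) (T x).
  rewrite /x linear_sum; under eq_bigr do rewrite linearZ.
  rewrite (@form_sum_orthogonal _ _ (fun j => T (u j))) => [|i j _ ji]; last first.
    exact: singular_image_orthogonal.
  rewrite mulr_sumr; apply: ler_sum => j _; rewrite mulrC.
  rewrite ler_wpM2l ?exprn_ge0 // form_hn lecR ler_sqr ?nnegrE ?hn_ge0 //.
  by apply: singular_nonincreasing; rewrite -ltnS.
rewrite -ler_sqr ?nnegrE ?hn_ge0 // -lecR -(ler_pM2r S0); apply: (le_trans TT).
rewrite -xx !form_hn -rmorphM lecR -exprMn ler_sqr ?nnegrE ?mulr_ge0 ?hn_ge0 //.
exact: hL.
Qed.

End SingularValues.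
End Hilbert.

(** * Sequences with geometric decay along blocks of indices *)

Section BlockSequences.
Variables (R : realType) (delta : nat) (s : nat -> R) (C rho : R).
Hypothesis delta_gt0 : (0 < delta)%N.
(** The number of words of length less than [M] over [delta] letters. *)
Definition block M := (\sum_(k < M) delta ^ k)%N.
Hypotheses (s_ge0 : forall n, 0 <= s n)
  (s_noninc : forall i j, (i <= j)%N -> s j <= s i).
Hypotheses (C0 : 0 <= C) (rho0 : 0 <= rho) (rho1 : rho < 1).
Hypothesis s_block : forall M, s (block M) <= C * rho ^+ M.

Lemma block_cvg0 : s @ \oo --> (0 : R).
Proof.
have geo : (fun M => C * rho ^+ M) @ \oo --> (0 : R).
  rewrite -(mulr0 C); apply: cvgMr; apply: cvg_expr.
  by rewrite ger0_norm.
apply/cvgr0Pnorm_lt => eps eps0.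
move/cvgr0Pnorm_lt : geo => /(_ _ eps0) [M _ /(_ M (leqnn M)) /= hM].
exists (block M) => // n /= nM; rewrite ger0_norm //.
apply: le_lt_trans hM; apply: le_trans (ler_norm _).
exact: le_trans (s_noninc nM) (s_block M).
Qed.

Lemma leq_block M : (M <= block M)%N.
Proof.
elim: M => [|M IHM] //; rewrite /block big_ord_recr /= -addn1.
by rewrite leq_add // expn_gt0 delta_gt0.
Qed.

(** The [delta ^ M] indices from [block M] to [block M.+1] carry terms of at most $C^r\rho^{rM}$, so
    the block contributes at most $C^r(\delta\rho^r)^M$, a term of a convergent geometric series. *)
Lemma block_summable (r : R) : 0 < r -> delta%:R * rho `^ r < 1 ->
  cvgn (series (fun n => s n `^ r)).
Proof.
move=> r0; set x := _ * _ => x1.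
have x0 : 0 <= x by rewrite mulr_ge0 // powR_ge0.
have term M : s (block M) `^ r <= C `^ r * (rho `^ r) ^+ M.
  apply: (@le_trans _ _ ((C * rho ^+ M) `^ r)).
    by rewrite ge0_ler_powR ?(ltW r0) ?nnegrE // mulr_ge0 // exprn_ge0.
  have <- : (rho ^+ M) `^ r = (rho `^ r) ^+ M.
    by rewrite -powR_mulrn // -powRrM mulrC powRrM powR_mulrn ?powR_ge0.
  by rewrite powRM ?exprn_ge0.
have sum M : \sum_(0 <= n < block M) s n `^ r
    <= C `^ r * \sum_(k < M) x ^+ k.
  elim: M => [|M IHM]; first by rewrite /block !big_ord0 big_geq // mulr0.
  rewrite [block _]big_ord_recr /= -/(block M).
  rewrite (@big_cat_nat _ _ _ (block M)) ?leq_addr //= big_ord_recr mulrDr lerD //.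
  apply: (@le_trans _ _ (\sum_(block M <= n < block M + delta ^ M)
                           s (block M) `^ r)).
    rewrite big_nat_cond [leRHS]big_nat_cond; apply: ler_sum => n.
    rewrite andbT => /andP[Mn _].
    by rewrite ge0_ler_powR ?(ltW r0) ?nnegrE // s_noninc.
  rewrite sumr_const_nat addKn /x exprMn -natrX [leRHS]mulrCA -[leLHS]mulr_natl.
  by rewrite ler_wpM2l.
apply: nondecreasing_is_cvgn.
  by apply: nondecreasing_series => n _ _; exact: powR_ge0.
exists (C `^ r * (1 - x)^-1) => _ [N _ <-].
apply: (@le_trans _ _ (\sum_(0 <= n < block N) s n `^ r)).
  rewrite [leRHS](@big_cat_nat _ _ _ N) ?leq_block //= lerDl.
  by apply: sumr_ge0 => n _; exact: powR_ge0.
apply: (le_trans (sum N)); rewrite ler_wpM2l ?powR_ge0 //.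
rewrite -[leRHS]mul1r ler_pdivlMr ?subr_gt0 // mulrC.
have -> : (1 - x) * \sum_(k < N) x ^+ k = 1 - x ^+ N.
  by rewrite -[in RHS](expr1n _ N) subrXX; congr (_ * _); apply: eq_bigr => k _;
     rewrite expr1n mul1r.
by rewrite gerBl exprn_ge0.
Qed.

End BlockSequences.

(** * The length function of the symmetric group *)

Section Inversions.
Variable n : nat.
Implicit Types r s t : 'S_n.

Lemma inversionsE s : inversions s
  = (\sum_(i < n) \sum_(j < n) ((i < j) && (s j < s i)))%N.
Proof.
rewrite /inversions -sum1_card big_mkcond /= pair_bigA /=.
by apply: eq_bigr => p _; rewrite unfold_in /in_set asboolb; case: (_ && _).
Qed.

(** On pairs with [p.1 < p.2] this is the complement of the inversion set of $r^{-1}$; passing to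
    complements does not change symmetric differences. *)
Definition ordered_by r (p : 'I_n * 'I_n) : bool :=
  (p.1 < p.2)%N && ((r^-1)%g p.1 < (r^-1)%g p.2)%N.

(** The product applies [r] first. Transported by [r], an inversion becomes a pair [(a, b)] put in
    this order by $r^{-1}$ and in the opposite order by $t^{-1}$; each unordered pair on which the
    two disagree is met exactly once. *)
Lemma inversions_symdiff r t :
  inversions (r * t^-1) = #|[pred p | ordered_by r p != ordered_by t p]|.
Proof.
pose E (a b : 'I_n) : bool :=
  ((r^-1)%g a < (r^-1)%g b)%N && ((t^-1)%g b < (t^-1)%g a)%N.
transitivity (\sum_(a < n) \sum_(b < n) E a b)%N.
  rewrite inversionsE [RHS](reindex_inj (@perm_inj _ r)) /=.
  apply: eq_bigr => i _; rewrite [RHS](reindex_inj (@perm_inj _ r)) /=.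
  by apply: eq_bigr => j _; rewrite /E !permK !permM.
have split_sum : (\sum_(a < n) \sum_(b < n) E a b
    = \sum_(a < n) \sum_(b < n) ((a < b) && E a b)
      + \sum_(a < n) \sum_(b < n) ((b < a) && E a b))%N.
  rewrite -big_split; apply: eq_bigr => a _; rewrite -big_split.
  apply: eq_bigr => b _ /=; case: ltngtP => [||ab] //; first by rewrite addn0.
  by rewrite (ord_inj ab) /E !ltnn.
rewrite split_sum [X in (_ + X)%N]exchange_big -big_split /=.
under eq_bigr do rewrite -big_split /=.
rewrite -sum1_card [RHS]big_mkcond pair_bigA /=; apply: eq_bigr => -[a b] _ /=.
rewrite inE /ordered_by /E /=; case: (ltnP a b) => //= ab.
have neq s : (s^-1)%g a != (s^-1)%g b.
  by rewrite (inj_eq perm_inj) -val_eqE /= ltn_eqF.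
have nr := neq r; have nt := neq t; rewrite -!val_eqE /= in nr nt.
by case: ltngtP nr => // _ _; case: ltngtP nt.
Qed.

Lemma increasing_perm1 s : {homo s : i j / (i < j)%N} -> s = 1%g.
Proof.
move=> s_incr; apply/permP => i; rewrite perm1.
have sE : [seq val (s j) | j <- enum 'I_n] = iota 0 n.
  apply: (irr_sorted_eq ltn_trans ltnn).
  - rewrite (sorted_map); apply/(sub_sorted (e := fun i j : 'I_n => (i < j)%N)).
      by move=> j k /s_incr.
    have := iota_ltn_sorted 0 n; rewrite -val_enum_ord sorted_map.
    by apply: sub_sorted.
  - exact: iota_ltn_sorted.
  move=> m; rewrite mem_iota /= add0n; apply/mapP/idP => [[j _ ->]|mn] //.
  by exists ((s^-1)%g (Ordinal mn)); rewrite ?mem_enum // permKV.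
apply/ord_inj; have := congr1 (nth 0%N ^~ i) sE.
rewrite (nth_map i) ?size_enum_ord // nth_ord_enum nth_iota //.
Qed.

(** Singles out the identity in [gram_coord_inversion], and so yields definiteness of the inner
    product. *)
Lemma ordered_by_inj1 t : ordered_by t =1 ordered_by 1%g -> t = 1%g.
Proof.
move=> h; rewrite -[t]invgK (@increasing_perm1 t^-1) ?invg1 // => i j ij.
by have := h (i, j); rewrite /ordered_by /= invg1 !perm1 ij.
Qed.

Definition rev_perm : 'S_n := perm (@rev_ord_inj n).

(** Reversal exchanges the roles of the two indices of an inversion and of their images. This makes
    [flip] an isometry. *)
Lemma inversions_rev s : inversions (rev_perm * s * rev_perm) = inversions s.
Proof.
rewrite !inversionsE exchange_big (reindex_inj (@rev_ord_inj n)) /=.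
apply: eq_bigr => i _; rewrite (reindex_inj (@rev_ord_inj n)) /=.
apply: eq_bigr => j _; rewrite !permM !permE !rev_ordK; congr (nat_of_bool _).
have ltn_rev (a b : 'I_n) : (rev_ord b < rev_ord a)%N = (a < b)%N.
  by rewrite /= ltn_sub2lE.
by rewrite !ltn_rev.
Qed.

Lemma rev_permK : (rev_perm * rev_perm = 1)%g.
Proof. by apply/permP => i; rewrite permM !permE rev_ordK. Qed.

End Inversions.

(** Since [k] is sent to 0, it forms an inversion with each of the [k] smaller indices and with no
    larger one; the remaining indices are lifted in order. *)
Lemma inversions_lift n (k : 'I_n.+1) (s : 'S_n) :
  inversions (lift_perm k ord0 s) = (k + inversions s)%N.
Proof.
rewrite !inversionsE (bigD1_ord k) //= big1 ?add0n => [|j _]; last first.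
  by rewrite lift_perm_id ltn0 andbF.
transitivity (\sum_(i < n) ((i < k)%N
    + \sum_(j < n) ((i < j) && (s j < s i))%N))%N.
  apply: eq_bigr => i _; rewrite (bigD1_ord k) //= lift_perm_id lift_perm_lift.
  congr (_ + _)%N.
    rewrite /= /bump leq0n /= andbT; congr (nat_of_bool _).
    by case: (leqP k i); lia.
  apply: eq_bigr => j _; rewrite !lift_perm_lift /= /bump !leq0n !add1n ltnS.
  congr (nat_of_bool (_ && _)); case: (leqP k i); case: (leqP k j) => //=; lia.
rewrite big_split /=; congr (_ + _)%N.
rewrite -[RHS]card_ord -sum1_card.
have kn : (k <= n)%N by rewrite -ltnS.
rewrite (big_ord_widen _ (fun=> 1%N) kn) [RHS]big_mkcond.
by apply: eq_bigr => i _; case: (_ < _)%N.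
Qed.

(** Permutations are sorted by the preimage [k] of 0. Together with [inversions_lift] this is the
    factorization of $P_q^{n+1}$ through $P_q^n$ that determines the annihilation operators. *)
Lemma sum_lift_perm (R : nmodType) n (F : 'S_n.+1 -> R) :
  \sum_s F s = \sum_(k < n.+1) \sum_(s : 'S_n) F (lift_perm k ord0 s).
Proof.
rewrite pair_bigA /= (reindex (fun p : 'I_n.+1 * 'S_n => lift_perm p.1 ord0 p.2)) //.
apply: onW_bij; apply: inj_card_bij => [[k s] [l t] /= st|].
  have kl : k = l.
    apply: (@perm_inj _ (lift_perm l ord0 t)).
    by rewrite lift_perm_id -st lift_perm_id.
  rewrite kl in st *; congr (_, _); apply/permP => i.
  apply: (@lift_inj _ ord0); by rewrite -!(lift_perm_lift l) st.
by rewrite card_prod !card_Sn card_ord factS.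
Qed.

(** * Positivity of the q-inner product *)

Section GramRepresentation.
Variables (R : realType) (d : nat) (q : R).
Local Notation vec := (vec R d).

Lemma permuteM n (s t : 'S_n) (w : n.-tuple 'I_d) :
  permute s (permute t w) = permute (s * t)%g w.
Proof. by apply: eq_from_tnth => k; rewrite !tnth_mktuple permM. Qed.

Lemma permute1 n (w : n.-tuple 'I_d) : permute 1%g w = w.
Proof. by apply: eq_from_tnth => k; rewrite tnth_mktuple perm1. Qed.

Lemma permute_bij n (s : 'S_n) : bijective (@permute d n s).
Proof.
by exists (permute (s^-1)%g) => w; rewrite permuteM ?mulVg ?mulgV permute1.
Qed.

Lemma ipqE n (x y : vec) : ipq q n x y =
  \sum_(v : n.-tuple 'I_d) \sum_(s : 'S_n)
     x v * (q ^+ inversions s)%:C * (y (permute s v))^*.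
Proof.
rewrite /ipq /Pq; under eq_bigr do rewrite mulr_suml.
rewrite exchange_big; apply: eq_bigr => v _ /=.
under eq_bigr do rewrite mulr_suml.
rewrite exchange_big; apply: eq_bigr => s _ /=.
rewrite (bigD1 (permute s v)) //= eqxx mulr1 big1 ?addr0 // => w /negPf.
by rewrite eq_sym => ->; rewrite mulr0 mul0r.
Qed.

(** [S] marks the tensor factors in which the sign character is taken instead of the trivial one. In
    each factor the matrix entry is $\frac{1+q}2+\frac{1-q}2\,\epsilon\epsilon'$ with signs
    $\epsilon,\epsilon'$, which is 1 or $q$. *)
Definition gram_weight n (S : {set 'I_n * 'I_n}) : R :=
  \prod_p (if p \in S then (1 - q) / 2 else (1 + q) / 2).

Definition gram_sign n (S : {set 'I_n * 'I_n}) (s : 'S_n) : R :=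
  \prod_(p in S) (-1) ^+ ordered_by s p.

Definition gram_coord n (v : n.-tuple 'I_d) (S : {set 'I_n * 'I_n}) (x : vec) :
  R[i] := \sum_(s : 'S_n) (gram_sign S s)%:C * x (permute s v).

(* As a kernel in (r, t) this is a restriction of a tensor power of the matrix
   [[1, q], [q, 1]], which the characters diagonalize with eigenvalues 1 - q and
   1 + q. *)
Lemma inversions_gram n (r t : 'S_n) : q ^+ inversions (r * t^-1)
  = \sum_(S : {set 'I_n * 'I_n})
      gram_weight S * gram_sign S r * gram_sign S t.
Proof.
rewrite inversions_symdiff -prodr_const big_mkcond /=.
pose F (p : 'I_n * 'I_n) : R :=
  (1 - q) / 2 * ((-1) ^+ ordered_by r p * (-1) ^+ ordered_by t p).
transitivity (\prod_(p : 'I_n * 'I_n) (F p + (1 + q) / 2)).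
  apply: eq_bigr => p _; rewrite /F unfold_in /=.
  by case: (ordered_by r p); case: (ordered_by t p) => /=;
     rewrite ?expr0 ?expr1; field.
rewrite bigA_distr; apply: eq_big => [S|S _]; first by rewrite inE.
rewrite /gram_weight /gram_sign -mulrA ![\prod_(p in S) _]big_mkcond /=.
rewrite -!big_split /=; apply: eq_bigr => p _.
by case: (p \in S); rewrite /F ?mulr1.
Qed.

(** Averaging the base word over $S_n$ turns $q^{i(s)}$ into the two-variable kernel
    $q^{i(rt^{-1})}$, whence the factor $n!$. The character expansion of the kernel then displays
    the form as a weighted sum of squares. *)
Lemma ipq_gram n (x y : vec) : (n`!)%:R * ipq q n x y =
  \sum_(v : n.-tuple 'I_d) \sum_(S : {set 'I_n * 'I_n})
     (gram_weight S)%:C * (gram_coord v S x * (gram_coord v S y)^*).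
Proof.
transitivity (\sum_(v : n.-tuple 'I_d) \sum_(t : 'S_n) \sum_(r : 'S_n)
    (q ^+ inversions (r * t^-1))%:C * (x (permute t v) * (y (permute r v))^*)).
  rewrite exchange_big /=.
  transitivity (\sum_(t : 'S_n) ipq q n x y).
    by rewrite sumr_const card_Sn mulr_natl.
  apply: eq_bigr => t _; rewrite ipqE.
  rewrite (reindex (permute t)); last by apply: onW_bij; exact: permute_bij.
  apply: eq_bigr => v _.
  rewrite (reindex_inj (mulIg t^-1)%g); apply: eq_bigr => r _.
  by rewrite permuteM mulgKV mulrAC mulrC.
apply: eq_bigr => v _.
transitivity (\sum_(t : 'S_n) \sum_(r : 'S_n) \sum_(S : {set 'I_n * 'I_n})
  (gram_weight S)%:C * (((gram_sign S t)%:C * x (permute t v))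
     * ((gram_sign S r)%:C * y (permute r v))^*)).
  apply: eq_bigr => t _; apply: eq_bigr => r _.
  rewrite inversions_gram rmorph_sum mulr_suml; apply: eq_bigr => S _ /=.
  by rewrite !real_complexM rmorphM /= conjC_real; ring.
under eq_bigr do rewrite exchange_big /=.
rewrite exchange_big; apply: eq_bigr => S _ /=.
under eq_bigr do rewrite -mulr_sumr.
rewrite -mulr_sumr; congr (_ * _).
rewrite /gram_coord rmorph_sum mulr_suml; apply: eq_bigr => t _.
by rewrite mulr_sumr.
Qed.

(** Orthogonality of characters: the sum over [S] factors over the pairs [p], and the factor at a
    pair that [t] and 1 order differently is $1-1=0$. Only [t = 1] survives, with a factor 2 for
    each pair. *)
Lemma gram_coord_inversion n (v : n.-tuple 'I_d) (x : vec) :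
  \sum_(S : {set 'I_n * 'I_n}) (gram_sign S 1)%:C * gram_coord v S x
  = 2 ^+ #|{: 'I_n * 'I_n}| * x v.
Proof.
transitivity (\sum_(t : 'S_n) \sum_(S : {set 'I_n * 'I_n})
  (gram_sign S 1 * gram_sign S t)%:C * x (permute t v)).
  rewrite exchange_big /=; apply: eq_bigr => S _; rewrite mulr_sumr.
  by apply: eq_bigr => t _; rewrite real_complexM mulrA.
have E t : \sum_(S : {set 'I_n * 'I_n}) gram_sign S 1 * gram_sign S t
    = \prod_(p : 'I_n * 'I_n)
        ((-1) ^+ ordered_by 1 p * (-1) ^+ ordered_by t p + 1) :> R.
  rewrite bigA_distr; apply: eq_big => [S|S _]; first by rewrite inE.
  rewrite /gram_sign ![\prod_(p in S) _]big_mkcond -big_split /=.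
  by apply: eq_bigr => p _; case: (p \in S); rewrite ?mulr1.
have [y yE] : exists y : 'S_n -> R[i], forall t, x (permute t v) = y t.
  by eexists=> t.
have -> : x v = y 1%g by rewrite -yE permute1.
under eq_bigr do under eq_bigr do rewrite yE.
rewrite (bigD1 1%g) //= [X in _ + X]big1 ?addr0 => [|t t1].
  rewrite -mulr_suml -rmorph_sum E; congr (_ * _).
  rewrite -prodr_const rmorph_prod; apply: eq_bigr => p _ /=.
  by rewrite -signr_addb addbb expr0 rmorphD rmorph1.
rewrite -mulr_suml -rmorph_sum E /=.
have [p hp] : exists p, ordered_by t p != ordered_by 1%g p.
  apply: contrapT => h; move/eqP: t1; apply; apply: ordered_by_inj1 => p.
  by apply/eqP; apply: contraT => hp; case: h; exists p.
rewrite (bigD1 p) //= -signr_addb.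
by rewrite -negb_eqb eq_sym hp expr1 addNr mul0r rmorph0 mul0r.
Qed.

Section Positivity.
Hypothesis hq : -1 < q < 1.

Lemma gram_weight_gt0 n (S : {set 'I_n * 'I_n}) : 0 < gram_weight S.
Proof.
case/andP: hq => q1 q2; apply: prodr_gt0 => p _.
by case: ifP => _; rewrite divr_gt0 //; lra.
Qed.

Let fact_gt0C n : 0 < (n`!)%:R :> R[i].
Proof. by rewrite ltr0n fact_gt0. Qed.

Lemma ipqC n (x y : vec) : ipq q n y x = (ipq q n x y)^*.
Proof.
apply: (mulfI (lt0r_neq0 (fact_gt0C n))).
transitivity (((n`!)%:R * ipq q n x y)^*); last by rewrite rmorphM /= conjC_nat.
rewrite !ipq_gram rmorph_sum.
apply: eq_bigr => v _; rewrite rmorph_sum; apply: eq_bigr => S _ /=.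
by rewrite !rmorphM /= conjC_real conjCK; congr (_ * _); rewrite mulrC.
Qed.

Lemma ipq_ge0 n (x : vec) : 0 <= ipq q n x x.
Proof.
rewrite -(pmulr_rge0 _ (fact_gt0C n)) ipq_gram.
apply: sumr_ge0 => v _; apply: sumr_ge0 => S _.
by rewrite mulr_ge0 ?mul_conjC_ge0 // ler0c ltW // gram_weight_gt0.
Qed.

Lemma ipq_real n (x : vec) : (complex.Re (ipq q n x x))%:C = ipq q n x x.
Proof. by rewrite RRe_real // ger0_real // ipq_ge0. Qed.

Lemma ipq_Re_ge0 n (x : vec) : 0 <= complex.Re (ipq q n x x).
Proof. by rewrite -ler0c ipq_real ipq_ge0. Qed.

(** Each [gram_coord] is controlled by a single term of the sum of squares, and the inversion
    formula recovers [x v] from them. Both definiteness and the boundedness of coordinates in the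
    unit ball rest on this. *)
Lemma ipq_coord_bound n : exists2 b : R, 0 <= b & forall (x : vec) (v : n.-tuple 'I_d),
  `|x v| <= (b * Num.sqrt (complex.Re (ipq q n x x)))%:C.
Proof.
pose c (S : {set 'I_n * 'I_n}) : R := Num.sqrt ((n`!)%:R / gram_weight S).
exists (\sum_(S : {set 'I_n * 'I_n}) c S).
  by apply: sumr_ge0 => S _; exact: sqrtr_ge0.
move=> x v; set N := Num.sqrt _.
have coord_le S : `|gram_coord v S x| <= (c S * N)%:C.
  rewrite /c /N -sqrtrM; last first.
    by rewrite divr_ge0 ?ler0n // ltW // gram_weight_gt0.
  have e0 : 0 <= n`!%:R / gram_weight S * complex.Re (ipq q n x x).
    by rewrite mulr_ge0 ?ipq_Re_ge0 // divr_ge0 ?ler0n // ltW // gram_weight_gt0.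
  rewrite -ler_sqr ?nnegrE ?normr_ge0 //; last by rewrite ler0c sqrtr_ge0.
  rewrite -[leRHS]real_complexX sqr_sqrtr //.
  rewrite real_complexM ipq_real real_complexM mulrAC rmorph_nat ipq_gram.
  rewrite fmorphV /= ler_pdivlMr ?ltcR ?gram_weight_gt0 //.
  rewrite mulrC normCK (bigD1 v) //= (bigD1 S) //= -addrA lerDl addr_ge0 //.
    by apply: sumr_ge0 => S' _;
       rewrite mulr_ge0 ?mul_conjC_ge0 // ler0c ltW // gram_weight_gt0.
  by apply: sumr_ge0 => w _; apply: sumr_ge0 => S' _;
     rewrite mulr_ge0 ?mul_conjC_ge0 // ler0c ltW // gram_weight_gt0.
have sign1 (S : {set 'I_n * 'I_n}) : `|(gram_sign S 1)%:C| = 1.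
  rewrite /gram_sign rmorph_prod normr_prod big1 // => p _ /=.
  by rewrite rmorphXn rmorphN rmorph1 normrX normrN1 expr1n.
have two : (1 : R[i]) <= 2 ^+ #|{: 'I_n * 'I_n}|.
  by rewrite exprn_ege1 // ler1n.
apply: (@le_trans _ _ (2 ^+ #|{: 'I_n * 'I_n}| * `|x v|)).
  by rewrite ler_peMl.
rewrite -[X in X * _]ger0_norm; last by rewrite (le_trans ler01).
rewrite -normrM -gram_coord_inversion.
apply: le_trans (ler_norm_sum _ _ _) _.
rewrite mulr_suml rmorph_sum; apply: ler_sum => S _.
by rewrite normrM sign1 mul1r.
Qed.

End Positivity.
End GramRepresentation.

(** * Creation and annihilation operators *)

Section Levels.
Variables (R : realType) (d : nat) (q : R).
Local Notation vec := (vec R d).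
Local Notation oper := (oper R d).
Implicit Types (x y z : vec) (i j : 'I_d) (w : seq 'I_d).

Lemma vecDE x y w : (x + y) w = x w + y w. Proof. by []. Qed.
Lemma vecZE (c : R[i]) x w : (c *: x) w = c * x w. Proof. by []. Qed.
Lemma vecBE x y w : (x - y) w = x w - y w. Proof. by []. Qed.
Lemma vecNE x w : (- x) w = - x w. Proof. by []. Qed.

Lemma eq_ipq n x x' y y' :
  (forall v : n.-tuple 'I_d, x v = x' v) ->
  (forall v : n.-tuple 'I_d, y v = y' v) -> ipq q n x y = ipq q n x' y'.
Proof.
move=> hx hy; rewrite !ipqE; apply: eq_bigr => v _; apply: eq_bigr => s _.
by rewrite hx hy.
Qed.

Lemma ipqDl n (c : R[i]) x y z :
  ipq q n (c *: x + y) z = c * ipq q n x z + ipq q n y z.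
Proof.
rewrite !ipqE mulr_sumr -big_split; apply: eq_bigr => v _.
rewrite mulr_sumr -big_split; apply: eq_bigr => s _ /=.
by rewrite vecDE vecZE !mulrDl !mulrA.
Qed.

Lemma ipqDr n (c : R[i]) x y z :
  ipq q n z (c *: x + y) = c^* * ipq q n z x + ipq q n z y.
Proof.
rewrite !ipqE mulr_sumr -big_split; apply: eq_bigr => v _.
rewrite mulr_sumr -big_split; apply: eq_bigr => s _ /=.
by rewrite vecDE vecZE rmorphD rmorphM /=; ring.
Qed.

Lemma ipq0l n y : ipq q n 0 y = 0.
Proof. by have := ipqDl n (-1) 0 0 y; rewrite scaler0 addr0 mulN1r addNr. Qed.

Lemma ipqZl n (c : R[i]) x z : ipq q n (c *: x) z = c * ipq q n x z.
Proof. by rewrite -[c *: x]addr0 ipqDl ipq0l addr0. Qed.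

Lemma ipq0r n y : ipq q n y 0 = 0.
Proof.
by have := ipqDr n (-1) 0 0 y; rewrite scaler0 addr0 rmorphN1 mulN1r addNr.
Qed.

Lemma ipqZr n (c : R[i]) x z : ipq q n z (c *: x) = c^* * ipq q n z x.
Proof. by rewrite -[c *: x]addr0 ipqDr ipq0r addr0. Qed.

Definition flip : oper := fun x w => x (rev w).

Lemma flipK : involutive flip.
Proof. by move=> x; apply/funext => w; rewrite /flip revK. Qed.

Lemma permute_rev n (v : n.-tuple 'I_d) :
  permute (rev_perm n) v = rev v :> seq 'I_d.
Proof.
case: n v => [|n] v; first by rewrite [v]tuple0 tuple0.
apply: (@eq_from_nth _ (tnth v ord0)) => [|k]; first by rewrite size_rev !size_tuple.
rewrite size_tuple => kn; rewrite nth_rev ?size_tuple //.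
rewrite -(tnth_nth _ _ (Ordinal kn)) tnth_mktuple permE (tnth_nth (tnth v ord0)) /=.
by rewrite subSS.
Qed.

Lemma ipq_flip n x y : ipq q n (flip x) (flip y) = ipq q n x y.
Proof.
rewrite !ipqE [RHS](reindex (permute (rev_perm n))); last first.
  by apply: onW_bij; exact: permute_bij.
apply: eq_bigr => v _.
rewrite [RHS](reindex_inj (mulIg (rev_perm n))) [RHS](reindex_inj (mulgI (rev_perm n))).
apply: eq_bigr => s _; rewrite /flip -!permute_rev !permuteM inversions_rev.
by rewrite -!mulgA rev_permK mulg1.
Qed.

Definition cr i : oper := creation (fun j => (j == i)%:R).

Arguments cr : simpl never.

Definition ins i k w := take k w ++ i :: drop k w.

(** The annihilation operator $l_q(e_i)^\ast$. It removes a letter [i] from position [k] of a word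
    with weight $q^k$; in terms of coordinates, removal becomes insertion. *)
Definition an i : oper := fun x w =>
  \sum_(k < (size w).+1) (q ^+ k)%:C * x (ins i k w).

Definition rcr i : oper := flip \o cr i \o flip.
Definition ran i : oper := flip \o an i \o flip.
Definition qN : oper := fun x w => (q ^+ size w)%:C * x w.

Lemma cr_cons i x j w : cr i x (j :: w) = (j == i)%:R * x w.
Proof. by []. Qed.

Lemma rcr_rcons i x j w : rcr i x (rcons w j) = (j == i)%:R * x w.
Proof. by rewrite /rcr /= /flip rev_rcons cr_cons revK. Qed.

Lemma crD i (c : R[i]) x y : cr i (c *: x + y) = c *: cr i x + cr i y.
Proof.
apply/funext => -[|j w]; rewrite vecDE vecZE; first by rewrite /cr mulr0 addr0.
by rewrite !cr_cons vecDE vecZE; ring.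
Qed.

Lemma anD i (c : R[i]) x y : an i (c *: x + y) = c *: an i x + an i y.
Proof.
apply/funext => w; rewrite vecDE vecZE /an mulr_sumr -big_split.
by apply: eq_bigr => k _; rewrite vecDE vecZE /=; ring.
Qed.

Lemma flipD (c : R[i]) x y : flip (c *: x + y) = c *: flip x + flip y.
Proof. by apply/funext. Qed.

Lemma rcrD i (c : R[i]) x y : rcr i (c *: x + y) = c *: rcr i x + rcr i y.
Proof. by rewrite /rcr /= flipD crD flipD. Qed.

Lemma ranD i (c : R[i]) x y : ran i (c *: x + y) = c *: ran i x + ran i y.
Proof. by rewrite /ran /= flipD anD flipD. Qed.

Lemma qND (c : R[i]) x y : qN (c *: x + y) = c *: qN x + qN y.
Proof.
by apply/funext => w; rewrite vecDE vecZE /qN vecDE vecZE; ring.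
Qed.

Lemma size_ins i k w : size (ins i k w) = (size w).+1.
Proof. by rewrite size_cat /= addnS -size_cat cat_take_drop. Qed.

Lemma permute_lift n (k : 'I_n.+1) (s : 'S_n) i (v : n.-tuple 'I_d) :
  permute (lift_perm k ord0 s) [tuple of i :: v] = ins i k (permute s v) :> seq _.
Proof.
apply: (@eq_from_nth _ i) => [|m]; first by rewrite size_ins !size_tuple.
rewrite size_tuple => mn; rewrite -(tnth_nth _ _ (Ordinal mn)) tnth_mktuple.
have kn : (k <= n)%N by rewrite -ltnS.
have sz : size (permute s v) = n by rewrite size_tuple.
rewrite /ins nth_cat size_take sz.
have -> : (if (k < n)%N then k : nat else n) = k by case: ltngtP kn.
case: (unliftP k (Ordinal mn)) => [j /[dup] mj -> | mk]; last first.
  have {}mk : m = k by rewrite -mk.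
  have -> : Ordinal mn = k by apply/ord_inj.
  by rewrite mk ltnn subnn lift_perm_id.
rewrite lift_perm_lift; have {}mj : m = bump k j := congr1 val mj.
have -> : tnth [tuple of i :: v] (lift ord0 (s j)) = nth i (permute s v) j.
  by rewrite -tnth_nth tnth_mktuple (tnth_nth i) /= (tnth_nth i).
rewrite mj /bump; case: (leqP k j) => kj.
  rewrite add1n ltnNge (leqW kj) /= subSn //= nth_drop.
  by rewrite subnKC.
by rewrite add0n kj nth_take.
Qed.

Lemma sum_tuple_cons (V : nmodType) n (F : n.+1.-tuple 'I_d -> V) :
  \sum_t F t = \sum_j \sum_(v : n.-tuple 'I_d) F [tuple of j :: v].
Proof.
rewrite pair_bigA /=.
rewrite (reindex (fun p : 'I_d * n.-tuple 'I_d => [tuple of p.1 :: p.2])) //=.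
exists (fun t => (thead t, [tuple of behead t])) => [[j v] _|t _] /=.
  by congr (_, _); apply/val_inj.
by rewrite -tuple_eta.
Qed.

(** Sort $S_{n+1}$ by the position [k] to which the leading letter [i] is moved: this inserts [i] at
    place [k] of the permuted rest and splits off $q^k$. *)
Lemma ipq_cr i n x y : ipq q n.+1 (cr i x) y = ipq q n x (an i y).
Proof.
rewrite !ipqE sum_tuple_cons (bigD1 i) //= [X in _ + X]big1 ?addr0; last first.
  move=> j ji; rewrite big1 // => v _; rewrite big1 // => s _.
  by rewrite cr_cons (negPf ji) !mul0r.
apply: eq_bigr => v _; rewrite sum_lift_perm exchange_big.
apply: eq_bigr => s _.
have [g gE] : exists g : nat -> R[i], forall k, y (ins i k (permute s v)) = g k.
  by eexists => k.
have -> : an i y (permute s v) = \sum_(k < n.+1) (q ^+ k)%:C * g k.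
  by rewrite /an size_tuple; apply: eq_bigr => k _; rewrite gE.
rewrite rmorph_sum mulr_sumr; apply: eq_bigr => k _.
rewrite cr_cons eqxx mul1r inversions_lift permute_lift gE /=.
by rewrite exprD real_complexM rmorphM /= conjC_real; ring.
Qed.

Lemma ipq0_cr i x y : ipq q 0 (cr i x) y = 0.
Proof.
by rewrite ipqE big1 // => v _; rewrite big1 // => s _; rewrite tuple0 !mul0r.
Qed.

(** The q-commutation relation. Insertion in front meets the created letter and gives the Kronecker
    term; every other insertion happens behind it, at the cost of one more factor [q]. *)
Lemma an_cr i j x : an i (cr j x) = (i == j)%:R *: x + q%:C *: cr j (an i x).
Proof.
apply/funext => w; rewrite vecDE !vecZE /an big_ord_recl /ins take0 drop0 /=.
rewrite cr_cons expr0 mul1r; congr (_ + _).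
case: w => [|k w]; first by rewrite big_ord0 mulr0.
rewrite cr_cons mulrCA !mulr_sumr; apply: eq_bigr => m _.
by rewrite /bump add1n /= cr_cons /ins exprS real_complexM; ring.
Qed.

Lemma cr_rcr i j x : cr i (rcr j x) = rcr j (cr i x).
Proof.
apply/funext => -[|k w]; first by [].
rewrite cr_cons; case/lastP: w => [|w l].
  by rewrite -[[:: k]]/(rcons [::] k) rcr_rcons /rcr /= /flip /cr /= !mulr0.
by rewrite rcr_rcons -rcons_cons rcr_rcons cr_cons mulrCA.
Qed.

(** Insertion before the last letter commutes with removing that letter. Only insertion at the very
    end interferes, and its weight is the power of [q] that is responsible for all the decay. *)
Lemma an_rcr i j x : an i (rcr j x) = rcr j (an i x) + (i == j)%:R *: qN x.
Proof.
apply/funext => w; rewrite vecDE vecZE; case/lastP: w => [|w l].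
  rewrite /an big_ord_recl big_ord0 addr0 /ins /= -[[:: i]]/(rcons [::] i).
  by rewrite rcr_rcons /rcr /= /flip /cr /qN /=; ring.
rewrite rcr_rcons /an size_rcons big_ord_recr /=; congr (_ + _); last first.
  rewrite /ins -[in take _ _](size_rcons w l) take_size.
  rewrite -[in drop _ _](size_rcons w l) drop_size cats1 rcr_rcons /qN size_rcons.
  by rewrite mulrCA.
rewrite mulr_sumr; apply: eq_bigr => k _.
have -> : ins i k (rcons w l) = rcons (ins i k w) l.
  have km : (k <= size w)%N by rewrite -ltnS.
  by rewrite /ins rcons_cat rcons_cons drop_rcons // -cats1 takel_cat.
by rewrite rcr_rcons; ring.
Qed.

(** The mirror image of [an_rcr] under word reversal. *)
Lemma cr_ran i j x : cr i (ran j x) = ran j (cr i x) - (i == j)%:R *: qN x.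
Proof.
have qNflip z : flip (qN (flip z)) = qN z.
  by apply/funext => w; rewrite /flip /qN revK size_rev.
have : ran j (cr i x) = (j == i)%:R *: qN x + cr i (ran j x).
  have := congr1 flip (an_rcr j i (flip x)).
  by rewrite addrC flipD qNflip /rcr /ran /= !flipK.
by move=> ->; rewrite [i == j]eq_sym addrC addKr.
Qed.

Section Bounds.
Hypothesis hq : -1 < q < 1.

Lemma ipq_eq0 x : (forall n, ipq q n x x = 0) -> x = 0.
Proof.
move=> h; apply/funext => w.
have [b _ /(_ x (in_tuple w))] := ipq_coord_bound d hq (size w).
by rewrite h sqrtr0 mulr0 normr_le0 => /eqP.
Qed.

(** The adjoint of [cr_rcr]: on each level the difference is orthogonal to itself, and the form is
    definite. *)
Lemma an_ran i j x : an i (ran j x) = ran j (an i x).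
Proof.
have ipq_ran n y z : ipq q n y (ran j z) = ipq q n.+1 (rcr j y) z.
  by rewrite -ipq_flip flipK -ipq_cr -ipq_flip flipK.
apply/eqP; rewrite -subr_eq0; apply/eqP; apply: ipq_eq0 => n.
set D := an i _ - _; rewrite {2}/D -scaleN1r addrC ipqDr rmorphN1 mulN1r.
by rewrite ipq_ran -!ipq_cr ipq_ran cr_rcr addNr.
Qed.

Let N n x : R := complex.Re (ipq q n x x).
Let ipqN n x : ipq q n x x = (N n x)%:C. Proof. by rewrite -ipq_real. Qed.

(** With [z = an i x], expand $\|x-C^{-1}l(e_i)z\|^2\ge0$. The cross term is $-2C^{-1}\|z\|^2$ by
    adjointness, and the bound on [cr i z] absorbs half of it. *)
Lemma an_le_of_cr_le (C : R) i n x : 0 < C ->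
  (forall z, N n.+1 (cr i z) <= C * N n z) -> N n (an i x) <= C * N n.+1 x.
Proof.
move=> C0 hC; set z := an i x.
have := ipq_ge0 hq n.+1 ((- C^-1)%:C *: cr i z + x).
have -> : ipq q n.+1 ((- C^-1)%:C *: cr i z + x) ((- C^-1)%:C *: cr i z + x)
  = (N n.+1 x - 2 * C^-1 * N n z + C^-1 ^+ 2 * N n.+1 (cr i z))%:C.
  rewrite ipqDl !ipqDr conjC_real [ipq _ _ x (cr i z)]ipqC //.
  rewrite [ipq _ _ (cr i z) x]ipq_cr -/z.
  rewrite !ipqN conjC_real /= -!(real_complexM, real_complexD); congr (_%:C).
  by ring.
rewrite ler0c; have := hC z; move: (N n.+1 _) (N n _) (N n.+1 _) => a b c h1 h2.
have Cn : C != 0 by rewrite gt_eqF.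
have : C^-1 ^+ 2 * c <= C^-1 * b.
  have -> : C^-1 * b = C^-1 ^+ 2 * (C * b) by field.
  by rewrite ler_wpM2l // sqr_ge0.
move=> h3; rewrite -ler_pdivrMl //; lra.
Qed.

(** The fixed point of $C=1+|q|C$, so that induction on the degree reproduces the same constant. *)
Definition cr_const : R := (1 - `|q|)^-1.

Lemma cr_const_gt0 : 0 < cr_const.
Proof. by rewrite invr_gt0 subr_gt0 ltr_norml. Qed.

(* By [an_cr], the squared norm of [cr i] on level n is at most 1 + |q| times
   the squared norm of its adjoint on level n, i.e. of [cr i] on level n - 1. *)
Lemma cr_level_le i n x : N n.+1 (cr i x) <= cr_const * N n x.
Proof.
have C0 := cr_const_gt0.
have C1 : 1 + `|q| * cr_const = cr_const.
  by rewrite /cr_const; field; rewrite gt_eqF // subr_gt0 ltr_norml.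
have C2 : 1 <= cr_const by rewrite -C1 lerDl mulr_ge0 // ltW.
have N0 m z : 0 <= N m z by exact: ipq_Re_ge0.
elim: n x => [|n IHn] x.
  rewrite {1}/N ipq_cr an_cr eqxx scale1r addrC ipqDr [ipq _ _ x (cr _ _)]ipqC //.
  by rewrite ipq0_cr rmorph0 mulr0 add0r -/(N 0 x) ler_peMl.
rewrite {1}/N ipq_cr an_cr eqxx scale1r addrC ipqDr [ipq _ _ x (cr _ _)]ipqC //.
rewrite ipq_cr !ipqN !conjC_real -real_complexM -real_complexD /=.
have := an_le_of_cr_le x C0 (fun z => IHn z); rewrite -[leRHS]/(_ * _) => h.
rewrite -[X in _ <= X * _]C1 mulrDl mul1r addrC lerD2l -mulrA.
apply: (@le_trans _ _ (`|q| * N n (an i x))).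
  by apply: ler_wpM2r => //; exact: ler_norm.
by apply: ler_wpM2l.
Qed.

Lemma an_level_le i n x : N n (an i x) <= cr_const * N n.+1 x.
Proof. by apply: an_le_of_cr_le; [exact: cr_const_gt0 | exact: cr_level_le]. Qed.

End Bounds.
End Levels.
Arguments flip {R d}.
Arguments cr : simpl never.

(** * The q-Fock space *)

Section FockSpace.
Variables (R : realType) (d : nat) (q : R) (hq : -1 < q < 1).
Local Notation vec := (vec R d).
Local Notation oper := (oper R d).
Implicit Types (x y z : vec) (w : seq 'I_d).

Definition level x n : R := complex.Re (ipq q n x x).
Definition nsq x : R := limn (series (level x)).

Lemma level_ge0 x n : 0 <= level x n. Proof. exact: ipq_Re_ge0. Qed.

Lemma level_nd x : nondecreasing_seq (series (level x)).
Proof. by apply: nondecreasing_series => n _ _; exact: level_ge0. Qed.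

Lemma fock_bounded x (K : R) : (forall n, series (level x) n <= K) ->
  fock q x /\ nsq x <= K.
Proof.
move=> h; have c : cvgn (series (level x)).
  by apply: nondecreasing_is_cvgn; [exact: level_nd | exists K => _ [n _ <-]].
by split=> //; apply: limr_le => //; exact: nearW.
Qed.

Lemma series_le_nsq x n : fock q x -> series (level x) n <= nsq x.
Proof. by move=> fx; apply: nondecreasing_cvgn_le => //; exact: level_nd. Qed.

Lemma level_le_nsq x n : fock q x -> level x n <= nsq x.
Proof.
move=> /(@series_le_nsq _ n.+1); apply: le_trans.
by rewrite seriesSr /= lerDr sumr_ge0 // => k _; exact: level_ge0.
Qed.

(** The parallelogram identity with one square dropped. *)
Lemma level_lin_le (c : R[i]) x y n : level (c *: x + y) n
  <= 2 * (complex.Re (c * c^*) * level x n + level y n).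
Proof.
have h := level_ge0 (c *: x - y) n.
suff <- : level (c *: x + y) n + level (c *: x - y) n
    = 2 * (complex.Re (c * c^*) * level x n + level y n) by rewrite lerDl.
have levelE z : ipq q n z z = (level z n)%:C by rewrite /level ipq_real.
have cc : c * c^* = (complex.Re (c * c^*))%:C.
  by rewrite RRe_real // ger0_real // mul_conjC_ge0.
have : ipq q n (c *: x + y) (c *: x + y) + ipq q n (c *: x - y) (c *: x - y)
    = 2 * (c * c^* * ipq q n x x + ipq q n y y).
  rewrite -[- y]scaleN1r !ipqDl !ipqDr !(ipqZl, ipqZr) rmorphN1.
  by ring.
rewrite !levelE cc -(rmorph_nat (real_complex R) 2) -!(rmorphM, rmorphD) /=.
by move=> /complexI.
Qed.

Lemma fockDZ (c : R[i]) x y : fock q x -> fock q y -> fock q (c *: x + y).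
Proof.
move=> fx fy; pose k := complex.Re (c * c^*).
have k0 : 0 <= k.
  by rewrite -ler0c RRe_real ?mul_conjC_ge0 // ger0_real // mul_conjC_ge0.
apply: (proj1 (@fock_bounded _ (2 * (k * nsq x + nsq y)) _)) => n.
apply: (@le_trans _ _ (2 * (k * series (level x) n + series (level y) n))).
  rewrite !mulr_sumr -big_split mulr_sumr /=.
  by apply: ler_sum => m _; exact: level_lin_le.
by rewrite ler_wpM2l // lerD ?ler_wpM2l // series_le_nsq.
Qed.

Lemma fock0 : fock q (0 : vec).
Proof.
apply: (proj1 (@fock_bounded _ 0 _)) => n; rewrite /series /= big1 // => k _.
by rewrite /level ipq0l.
Qed.

Lemma fockD x y : fock q x -> fock q y -> fock q (x + y).
Proof. by move=> fx fy; rewrite -[x]scale1r; exact: fockDZ. Qed.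

Lemma fockZ (c : R[i]) x : fock q x -> fock q (c *: x).
Proof. by move=> fx; rewrite -[c *: x]addr0; apply: fockDZ => //; exact: fock0. Qed.

Lemma fockB x y : fock q x -> fock q y -> fock q (x - y).
Proof. by move=> fx fy; apply: fockD => //; rewrite -scaleN1r; exact: fockZ. Qed.

(** From $\|x+y\|^2\ge0$ and $\|x-y\|^2\ge0$; it makes the series defining [fip] converge
    absolutely. *)
Lemma ipq_Re_le n x y :
  `|complex.Re (ipq q n x y)| <= level x n + level y n.
Proof.
have polar s : ipq q n (s%:C *: x + y) (s%:C *: x + y)
    = (s ^+ 2 * level x n + 2 * s * complex.Re (ipq q n x y) + level y n)%:C.
  rewrite !ipqDl !ipqDr conjC_real (ipqC q n x y).
  have -> : ipq q n x x = (level x n)%:C by rewrite /level ipq_real.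
  have -> : ipq q n y y = (level y n)%:C by rewrite /level ipq_real.
  rewrite [X in _ = (X + _)%:C]addrC.
  apply/eqP; rewrite eq_complex; case: (ipq q n x y) => a b /=.
  by apply/andP; split; apply/eqP; ring.
have := ipq_ge0 hq n (1%:C *: x + y); have := ipq_ge0 hq n ((-1)%:C *: x + y).
have := level_ge0 x n; have := level_ge0 y n.
rewrite !polar !ler0c ler_norml; lra.
Qed.

Lemma ipq_Im n x y :
  complex.Im (ipq q n x y) = complex.Re (ipq q n (- 'i%C *: x) y).
Proof. by rewrite ipqZl; case: (ipq q n x y) => a b /=; ring. Qed.

Lemma cvg_ipq_Re x y : fock q x -> fock q y ->
  cvgn (series (fun n => complex.Re (ipq q n x y))).
Proof.
move=> fx fy; apply: normed_cvg.
apply: (@series_le_cvg _ _ (level x + level y)) => [n|n|n|].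
- exact: normr_ge0.
- by rewrite addr_ge0 ?level_ge0.
- exact: ipq_Re_le.
- exact: is_cvg_seriesD.
Qed.

Lemma cvg_ipq_Im x y : fock q x -> fock q y ->
  cvgn (series (fun n => complex.Im (ipq q n x y))).
Proof.
move=> fx fy; under [fun n => _]eq_fun do rewrite ipq_Im.
by apply: cvg_ipq_Re => //; exact: fockZ.
Qed.

Lemma fipDl (c : R[i]) x y z : fock q x -> fock q y -> fock q z ->
  fip q (c *: x + y) z = c * fip q x z + fip q y z.
Proof.
move=> fx fy fz; rewrite /fip; case: c => a b.
have cR := cvg_ipq_Re; have cI := cvg_ipq_Im.
set uR := fun n => complex.Re (ipq q n x z).
set uI := fun n => complex.Im (ipq q n x z).
set vR := fun n => complex.Re (ipq q n y z).
set vI := fun n => complex.Im (ipq q n y z).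
have -> : (fun n => complex.Re (ipq q n ((a +i* b) *: x + y) z))
    = a *: uR - b *: uI + vR.
  apply/funext => n; rewrite ipqDl !fctE /uR /uI /vR.
  by case: (ipq q n x z) => ? ?; case: (ipq q n y z).
have -> : (fun n => complex.Im (ipq q n ((a +i* b) *: x + y) z))
    = a *: uI + b *: uR + vI.
  apply/funext => n; rewrite ipqDl !fctE /uR /uI /vI.
  by case: (ipq q n x z) => ? ?; case: (ipq q n y z).
have cuR : cvgn (series uR) by exact: cR.
have cuI : cvgn (series uI) by exact: cI.
have cvR : cvgn (series vR) by exact: cR.
have cvI : cvgn (series vI) by exact: cI.
have Z (u : R^nat) k : cvgn (series u) -> cvgn (series (k *: u)).
  exact: is_cvg_seriesZ.
rewrite lim_seriesD //; last by apply: is_cvg_seriesB; exact: Z.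
rewrite lim_seriesB; [|exact: Z|exact: Z].
rewrite lim_seriesD //; last by apply: is_cvg_seriesD; exact: Z.
rewrite lim_seriesD; [|exact: Z|exact: Z].
by rewrite !lim_seriesZ.
Qed.

Lemma fipC x y : fock q x -> fock q y -> fip q y x = (fip q x y)^*.
Proof.
move=> fx fy; rewrite /fip.
have -> : (fun n => complex.Re (ipq q n y x)) = (fun n => complex.Re (ipq q n x y)).
  by apply/funext => n; rewrite (ipqC q n x y); case: (ipq q n x y).
have -> : (fun n => complex.Im (ipq q n y x)) = - (fun n => complex.Im (ipq q n x y)).
  by apply/funext => n; rewrite (ipqC q n x y) fctE; case: (ipq q n x y).
by rewrite lim_seriesN //; exact: cvg_ipq_Im.
Qed.

Lemma fip_nsq x : fip q x x = (nsq x)%:C.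
Proof.
rewrite /fip -/(level x) -/(nsq x); congr (_ +i* _).
have -> : (fun n => complex.Im (ipq q n x x)) = fun=> 0.
  by apply/funext => n; rewrite -ipq_real.
suff -> : series (fun=> 0 : R) = fun=> 0 by exact: lim_cst.
by apply/funext => n; rewrite /series /= big1.
Qed.

Lemma nsq_ge0 x : fock q x -> 0 <= nsq x.
Proof.
move=> fx; apply: le_trans (series_le_nsq 0 fx).
by rewrite /series /= big_geq.
Qed.

Lemma nsq_eq0 x : fock q x -> nsq x = 0 -> x = 0.
Proof.
move=> fx x0; apply: (ipq_eq0 hq) => n; rewrite -ipq_real // -/(level x n).
by congr (_%:C); apply/le_anti; rewrite level_ge0 -x0 level_le_nsq.
Qed.

Lemma fnormE x : fnorm q x = Num.sqrt (nsq x). Proof. by []. Qed.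

Lemma fnorm_sq x : fock q x -> fnorm q x ^+ 2 = nsq x.
Proof. by move=> fx; rewrite fnormE sqr_sqrtr // nsq_ge0. Qed.

End FockSpace.

(** [fock] is a predicate on formal vectors; bundling it as a type provides the module to which the
    abstract singular value construction applies. *)
Record fockT (R : realType) (d : nat) (q : R) (hq : -1 < q < 1) :=
  FockT { fval : vec R d; fval_fock : fock q fval }.
Arguments FockT {R d q} hq {fval}.
Arguments fval_fock {R d q hq} f.

Section FockModule.
Variables (R : realType) (d : nat) (q : R) (hq : -1 < q < 1).
Local Notation V := (fockT d hq).

HB.instance Definition _ := gen_eqMixin V.
HB.instance Definition _ := gen_choiceMixin V.

Lemma fval_inj : injective (@fval R d q hq).
Proof.
move=> [x fx] [y fy] /= xy; rewrite xy in fx *; congr FockT.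
exact: Prop_irrelevance.
Qed.

Lemma fockN (x : vec R d) : fock q x -> fock q (- x).
Proof. by rewrite -scaleN1r; exact: (fockZ hq). Qed.

Definition fock_zero : V := FockT hq (fock0 hq).
Definition fock_opp (x : V) : V := FockT hq (fockN (fval_fock x)).
Definition fock_add (x y : V) : V :=
  FockT hq (fockD hq (fval_fock x) (fval_fock y)).
Definition fock_scale (c : R[i]) (x : V) : V :=
  FockT hq (fockZ (c := c) hq (fval_fock x)).

Lemma fock_addA : associative fock_add.
Proof. by move=> x y z; apply: fval_inj; exact: addrA. Qed.
Lemma fock_addC : commutative fock_add.
Proof. by move=> x y; apply: fval_inj; exact: addrC. Qed.
Lemma fock_add0 : left_id fock_zero fock_add.
Proof. by move=> x; apply: fval_inj; exact: add0r. Qed.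
Lemma fock_addN : left_inverse fock_zero fock_opp fock_add.
Proof. by move=> x; apply: fval_inj; exact: addNr. Qed.

HB.instance Definition _ :=
  GRing.isZmodule.Build V fock_addA fock_addC fock_add0 fock_addN.

Lemma fock_scaleA c e (x : V) :
  fock_scale c (fock_scale e x) = fock_scale (c * e) x.
Proof. by apply: fval_inj; exact: scalerA. Qed.
Lemma fock_scale1 : left_id 1 fock_scale.
Proof. by move=> x; apply: fval_inj; exact: scale1r. Qed.
Lemma fock_scaleDr : right_distributive fock_scale +%R.
Proof. by move=> c x y; apply: fval_inj; exact: scalerDr. Qed.
Lemma fock_scaleDl (x : V) : {morph fock_scale^~ x : c e / c + e}.
Proof. by move=> c e; apply: fval_inj; exact: scalerDl. Qed.

HB.instance Definition _ := GRing.Zmodule_isLmodule.Build R[i] V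
  fock_scaleA fock_scale1 fock_scaleDr fock_scaleDl.

End FockModule.

Section FockHilbert.
Variables (R : realType) (d : nat) (q : R) (hq : -1 < q < 1).
Local Notation vec := (vec R d).
Local Notation oper := (oper R d).
Local Notation V := (fockT d hq).
Implicit Types (x y z : vec) (w : seq 'I_d).

Lemma fvalDZ (c : R[i]) (x y : V) : fval (c *: x + y) = c *: fval x + fval y.
Proof. by []. Qed.

Definition fform (x y : V) : R[i] := fip q (fval x) (fval y).

Lemma fformDl (c : R[i]) (x y z : V) :
  fform (c *: x + y) z = c * fform x z + fform y z.
Proof. by rewrite /fform fvalDZ (fipDl hq) //; exact: fval_fock. Qed.

Lemma fformC (x y : V) : fform y x = (fform x y)^*.
Proof. by apply: (fipC hq); exact: fval_fock. Qed.

Lemma fform_ge0 (x : V) : 0 <= fform x x.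
Proof. by rewrite /fform (fip_nsq hq) ler0c (nsq_ge0 hq) //; exact: fval_fock. Qed.

Lemma fform_eq0 (x : V) : fform x x = 0 -> x = 0.
Proof.
rewrite /fform (fip_nsq hq) => /complexI x0; apply: fval_inj.
by apply: (nsq_eq0 hq) => //; exact: fval_fock.
Qed.

Lemma hn_fform (x : V) : hn fform x = fnorm q (fval x).
Proof. by rewrite /hn /fform (fip_nsq hq). Qed.

Lemma fnormD x y : fock q x -> fock q y -> fnorm q (x + y) <= fnorm q x + fnorm q y.
Proof.
move=> fx fy.
by have := hnD fformDl fformC fform_ge0 fform_eq0 (FockT hq fx) (FockT hq fy);
   rewrite !hn_fform.
Qed.

Lemma fnormZ (c : R[i]) x : fock q x -> (fnorm q (c *: x))%:C = `|c| * (fnorm q x)%:C.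
Proof.
move=> fx.
by have := hnZ fformDl fformC fform_ge0 c (FockT hq fx); rewrite !hn_fform.
Qed.

Lemma fnormN x : fock q x -> fnorm q (- x) = fnorm q x.
Proof.
move=> fx; apply: (@complexI R).
by rewrite -scaleN1r fnormZ // normrN normr1 mul1r.
Qed.

Lemma fnormB x y : fock q x -> fock q y -> fnorm q (x - y) <= fnorm q x + fnorm q y.
Proof.
move=> fx fy; rewrite -[fnorm q y]fnormN //; apply: fnormD => //.
by rewrite -scaleN1r; apply: (fockZ hq).
Qed.

Lemma fip_cauchy_schwarz x y : fock q x -> fock q y ->
  `|fip q x y| <= (fnorm q x * fnorm q y)%:C.
Proof.
move=> fx fy.
by have := cauchy_schwarz fformDl fformC fform_ge0 fform_eq0
     (FockT hq fx) (FockT hq fy); rewrite !hn_fform.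
Qed.

Lemma fnorm_ge0 x : 0 <= fnorm q x. Proof. exact: sqrtr_ge0. Qed.

Lemma fnorm_eq0 x : fock q x -> fnorm q x = 0 -> x = 0.
Proof.
move=> fx x0; apply: (nsq_eq0 hq) => //.
by rewrite -(fnorm_sq hq) // x0 expr0n.
Qed.

Lemma fipBl x y z : fock q x -> fock q y -> fock q z ->
  fip q (x - y) z = fip q x z - fip q y z.
Proof.
move=> fx fy fz.
by have := formBl fformDl (FockT hq fx) (FockT hq fy) (FockT hq fz).
Qed.

Lemma fipBr x y z : fock q x -> fock q y -> fock q z ->
  fip q z (x - y) = fip q z x - fip q z y.
Proof.
move=> fx fy fz.
by have := formBr fformDl fformC (FockT hq fx) (FockT hq fy) (FockT hq fz).
Qed.

(** Adjoints are thereby unique on [fock]. *)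
Lemma fip_right_inj y y' : fock q y -> fock q y' ->
  (forall x, fock q x -> fip q x y = fip q x y') -> y = y'.
Proof.
move=> fy fy' h; apply/eqP; rewrite -subr_eq0; apply/eqP.
have fyy : fock q (y - y') by exact: (fockB hq).
apply: (nsq_eq0 hq) => //; apply: (@complexI R).
by rewrite -(fip_nsq hq) fipBr // h // subrr.
Qed.

Definition trunc M : oper := fun x w => if (size w < M)%N then x w else 0.
(** These are the vectors of high degree: [M] is a lower bound for the degrees that occur. *)
Definition low M x := forall w, (size w < M)%N -> x w = 0.

Lemma level_trunc M x n :
  level q (trunc M x) n = if (n < M)%N then level q x n else 0.
Proof.
rewrite /level; case: ifP => nM.
  by congr complex.Re; apply: eq_ipq => v; rewrite /trunc size_tuple nM.
rewrite (@eq_ipq _ _ _ n (trunc M x) 0 (trunc M x) 0) ?ipq0l // => v;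
  by rewrite /trunc size_tuple nM.
Qed.

Lemma level_sub_trunc M x n :
  level q (x - trunc M x) n = if (n < M)%N then 0 else level q x n.
Proof.
rewrite /level; case: ifP => nM.
  rewrite (@eq_ipq _ _ _ n _ 0 _ 0) ?ipq0l // => v;
  by rewrite vecBE /trunc size_tuple nM subrr.
by congr complex.Re; apply: eq_ipq => v; rewrite vecBE /trunc size_tuple nM subr0.
Qed.

Lemma low_sub_trunc M x : low M (x - trunc M x).
Proof. by move=> w wM; rewrite vecBE /trunc wM subrr. Qed.

Lemma series_trunc M x n :
  series (level q (trunc M x)) n = series (level q x) (minn n M).
Proof.
case: (leqP n M) => [nM|/ltnW Mn]; rewrite /series /=.
  rewrite big_nat_cond [RHS]big_nat_cond; apply: eq_bigr => k /andP[kn _].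
  by rewrite level_trunc (leq_trans _ nM).
rewrite [RHS](big_nat_widen _ _ _ _ _ Mn) [RHS]big_mkcond /=.
by apply: eq_bigr => k _; rewrite level_trunc.
Qed.

Lemma trunc_fock M x : fock q (trunc M x) /\ nsq q (trunc M x) = series (level q x) M.
Proof.
have h : forall n, series (level q (trunc M x)) n <= series (level q x) M.
  by move=> n; rewrite series_trunc; apply: level_nd => //; rewrite geq_minr.
have [f l] := fock_bounded hq h; split=> //; apply/le_anti; rewrite l /=.
by have := series_le_nsq hq M f; rewrite series_trunc minnn.
Qed.

Lemma fock_trunc_bounded (K : R) x : 0 <= K -> (forall M, fnorm q (trunc M x) <= K) ->
  fock q x /\ fnorm q x <= K.
Proof.
move=> K0 h.
have h2 n : series (level q x) n <= K ^+ 2.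
  have [f <-] := trunc_fock n x.
  by rewrite -(fnorm_sq hq) // ler_sqr ?nnegrE // fnorm_ge0.
have [f l] := fock_bounded hq h2; split=> //.
by rewrite -ler_sqr ?nnegrE ?fnorm_ge0 // (fnorm_sq hq).
Qed.

Lemma fnorm_trunc_le M x : fock q x -> fnorm q (trunc M x) <= fnorm q x.
Proof.
move=> fx; have [f l] := trunc_fock M x.
by rewrite -ler_sqr ?nnegrE ?fnorm_ge0 // !(fnorm_sq hq) // l series_le_nsq.
Qed.

Lemma sub_trunc_fock M x : fock q x -> fock q (x - trunc M x).
Proof. by move=> fx; apply: (fockB hq) => //; exact: (proj1 (trunc_fock M x)). Qed.

Lemma series_sub_trunc M x n : (M <= n)%N ->
  series (level q (x - trunc M x)) n = series (level q x) n - series (level q x) M.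
Proof.
move=> Mn; rewrite /series /= sub_series_geq //.
rewrite (@big_cat_nat _ _ _ M) //= big_nat_cond big1 ?add0r => [|k]; last first.
  by rewrite andbT => /andP[_ kM]; rewrite level_sub_trunc kM.
rewrite big_nat_cond [RHS]big_nat_cond; apply: eq_bigr => k.
by rewrite andbT => /andP[Mk _]; rewrite level_sub_trunc ltnNge Mk.
Qed.

Lemma fnorm_sub_trunc_le M x : fock q x -> fnorm q (x - trunc M x) <= fnorm q x.
Proof.
move=> fx; rewrite -ler_sqr ?nnegrE ?fnorm_ge0 // !(fnorm_sq hq) //; last first.
  exact: sub_trunc_fock.
apply: (proj2 (fock_bounded hq _)) => n.
apply: le_trans (series_le_nsq hq n fx).
by apply: ler_sum => k _; rewrite level_sub_trunc; case: ifP => // _; exact: level_ge0.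
Qed.

Lemma sub_trunc_cvg0 x : fock q x ->
  (fun M => fnorm q (x - trunc M x)) @ \oo --> (0 : R).
Proof.
move=> fx; apply/cvgr0Pnorm_lt => e e0.
have : series (level q x) @ \oo --> nsq q x by exact: fx.
move=> /cvgrPdist_lt /(_ (e ^+ 2)) [|M _ hM]; first by rewrite exprn_gt0.
exists M => // N /= MN; rewrite ger0_norm ?fnorm_ge0 //.
rewrite -ltr_sqr ?nnegrE ?fnorm_ge0 ?(ltW e0) // (fnorm_sq hq); last first.
  exact: sub_trunc_fock.
apply: le_lt_trans (hM N MN).
rewrite ger0_norm ?subr_ge0 ?series_le_nsq //.
apply: (proj2 (fock_bounded hq _)) => n.
have [Nn|nN] := leqP N n.
  by rewrite series_sub_trunc // lerD2r series_le_nsq.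
apply: (@le_trans _ _ 0); last by rewrite subr_ge0 series_le_nsq.
rewrite /series /= big_nat_cond big1 // => k; rewrite andbT => /andP[_ kn].
by rewrite level_sub_trunc (ltn_trans kn nN).
Qed.

End FockHilbert.

(** * Singular values of operators that decay along the grading *)

(** Compactness of a segment. An ultrafilter gives limits of all coordinates at once and takes the
    place of a diagonal extraction of subsequences. *)
Lemma ultra_bounded_cvg (R : realType) (U : set_system nat) (f : nat -> R) (b : R) :
  UltraFilter U -> (forall k, `|f k| <= b) -> exists l : R, f k @[k --> U] --> l.
Proof.
move=> UU fb.
have [|p [_ pcl]] := @segment_compact R (- b) b (f @ U) _.
  suff : U (f @^-1` `[- b, b]) by [].
  by apply: filterE => k; rewrite /= in_itv /= -ler_norml.
exists p => A pA; have [//|UnA] := in_ultra_setVsetC (f @^-1` A) UU.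
by have [y [nAy Ay]] := pcl (~` A) A UnA pA.
Qed.

Lemma normc_ge_Im (R : rcfType) (z : R[i]) : `|complex.Im z|%:C <= `|z|.
Proof.
have -> : `|complex.Im z| = `|complex.Re (z * 'i%C)| by rewrite ReiNIm normrN.
apply: le_trans (normc_ge_Re _) _.
by rewrite normrM [X in _ * X]normc_def /= expr0n expr1n add0r sqrtr1 mulr1.
Qed.

Lemma cvg_finsum (R : realType) (T I : Type) (F : set_system T) (FF : Filter F)
  (r : seq I) (f : I -> T -> R) (l : I -> R) :
  (forall i, f i t @[t --> F] --> l i) ->
  (\sum_(i <- r) f i t) @[t --> F] --> \sum_(i <- r) l i.
Proof.
move=> h; elim: r => [|i r IHr].
  by rewrite big_nil; under eq_fun do rewrite big_nil; exact: cvg_cst.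
by rewrite big_cons; under eq_fun do rewrite big_cons; exact: cvgD.
Qed.

Section WeakCompactness.
Variables (R : realType) (d : nat) (q : R) (hq : -1 < q < 1).
Local Notation vec := (vec R d).
Local Notation oper := (oper R d).
Implicit Types (x y z : vec) (w : seq 'I_d).

(** On norm-bounded sets this is weak convergence. *)
Definition cvg_coord (T : Type) (F : set_system T) (z : T -> vec) (z0 : vec) :=
  forall w, complex.Re (z t w) @[t --> F] --> complex.Re (z0 w) /\
            complex.Im (z t w) @[t --> F] --> complex.Im (z0 w).

Lemma cvg_series_level (T : Type) (F : set_system T) (FF : Filter F)
  (z : T -> vec) (z0 : vec) M : cvg_coord F z z0 ->
  series (level q (z t)) M @[t --> F] --> series (level q z0) M.
Proof.
move=> h.
have levelE x n : level q x n = \sum_(v : n.-tuple 'I_d) \sum_(s : 'S_n)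
    (q ^+ inversions s * (complex.Re (x v) * complex.Re (x (permute s v))
       + complex.Im (x v) * complex.Im (x (permute s v)))).
  rewrite /level ipqE; pose ReC := (@complex.Re R : Rcomplex R -> R).
  rewrite (raddf_sum ReC); apply: eq_bigr => v _.
  rewrite (raddf_sum ReC); apply: eq_bigr => s _; rewrite /ReC.
  case: (x v) (x (permute s v)) => a b [a' b'] /=; ring.
rewrite /series /=; under eq_fun do under eq_bigr do rewrite levelE.
under eq_bigr do rewrite levelE.
apply: cvg_finsum => n; apply: cvg_finsum => v; apply: cvg_finsum => s.
apply: cvgMr; apply: cvgD; apply: cvgM; by case: (h v) (h (permute s v)) => ? ? [].
Qed.

(** Coordinates are bounded on the unit ball, so they have limits along [U]. Truncated norms are
    continuous in finitely many coordinates, hence pass to the limit and keep it in the ball. *)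
Lemma bounded_cvg_coord (U : set_system nat) (z : nat -> vec) : UltraFilter U ->
  (forall k, fock q (z k) /\ fnorm q (z k) <= 1) ->
  exists z0, [/\ fock q z0, fnorm q z0 <= 1 & cvg_coord U z z0].
Proof.
move=> UU zP.
have coord w : exists b : R, forall k, `|complex.Re (z k w)| <= b /\
                                      `|complex.Im (z k w)| <= b.
  have [b b0 hb] := ipq_coord_bound d hq (size w); exists b => k.
  have [fz z1] := zP k.
  have bz : `|z k w| <= b%:C.
    apply: le_trans (hb (z k) (in_tuple w)) _; rewrite lecR -[leRHS]mulr1.
    rewrite ler_wpM2l // (le_trans _ z1) // ler_sqrt ?(nsq_ge0 hq) //.
    exact: (level_le_nsq hq).
  split; rewrite -lecR; apply: le_trans bz; first exact: normc_ge_Re.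
  exact: normc_ge_Im.
have lim w : exists l : R[i], complex.Re (z k w) @[k --> U] --> complex.Re l /\
                              complex.Im (z k w) @[k --> U] --> complex.Im l.
  have [b bP] := coord w.
  have [a aP] := ultra_bounded_cvg UU (fun k => proj1 (bP k)).
  have [e eP] := ultra_bounded_cvg UU (fun k => proj2 (bP k)).
  by exists (a +i* e).
have [z0 z0P] := choice lim; exists z0.
have [|f l] := @fock_trunc_bounded R d q hq 1 z0 ler01; last by [].
move=> M; have fz0 := trunc_fock hq M z0.
rewrite fnormE -[leRHS]sqrtr1 ler_sqrt // (proj2 fz0).
have c : series (level q (z k)) M @[k --> U] --> series (level q z0) M.
  exact: cvg_series_level.
rewrite -(cvg_lim _ c) //; apply: limr_le; first by apply/cvg_ex; eexists; exact: c.
apply: nearW => k; have [fz z1] := zP k.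
apply: (le_trans (series_le_nsq hq M fz)).
by rewrite -(fnorm_sq hq) // -(expr1n _ 2) ler_sqr ?nnegrE ?fnorm_ge0.
Qed.

Lemma cvg_coord_trunc_sub (U : set_system nat) (z : nat -> vec) z0 M :
  ProperFilter U -> cvg_coord U z z0 ->
  fnorm q (trunc M (z k - z0)) @[k --> U] --> (0 : R).
Proof.
move=> UU h.
have h0 : cvg_coord U (fun k => z k - z0) 0.
  move=> w; have [h1 h2] := h w; split.
    rewrite -[complex.Re _](subrr (complex.Re (z0 w))).
    under eq_fun do rewrite vecBE (raddfB (@complex.Re R : Rcomplex R -> R)).
    by apply: cvgB => //; exact: cvg_cst.
  rewrite -[complex.Im (_ w)](subrr (complex.Im (z0 w))).
  under eq_fun do rewrite vecBE (raddfB (@complex.Im R : Rcomplex R -> R)).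
  by apply: cvgB => //; exact: cvg_cst.
have : series (level q (z k - z0)) M @[k --> U] --> series (level q (0 : vec)) M.
  exact: cvg_series_level.
have -> : series (level q (0 : vec)) M = 0.
  by rewrite /series /= big1 // => n _; rewrite /level ipq0l.
move=> c; rewrite -sqrtr0.
under eq_fun do rewrite fnormE (proj2 (trunc_fock hq M _)).
by apply: continuous_cvg c; exact: sqrt_continuous.
Qed.

Lemma fip_trunc_r M x y : fip q x (trunc M y) = fip q (trunc M x) (trunc M y).
Proof.
have E n : ipq q n x (trunc M y) = ipq q n (trunc M x) (trunc M y).
  have [nM|Mn] := ltnP n M.
    by apply: eq_ipq => v; rewrite /trunc size_tuple nM.
  have t0 t : ipq q n t (trunc M y) = ipq q n t 0.
    by apply: eq_ipq => v //; rewrite /trunc size_tuple ltnNge Mn.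
  by rewrite !t0 !ipq0r.
by rewrite /fip; under eq_fun do rewrite E; congr (_ +i* limn (series _));
   apply/funext => n; rewrite E.
Qed.

(** The case [M = 0] is boundedness. *)
Definition decay (rho : R) (T : oper) :=
  (forall (c : R[i]) x y, T (c *: x + y) = c *: T x + T y) /\
  exists2 C : R, 0 <= C & forall M x, fock q x -> low M x ->
    fock q (T x) /\ fnorm q (T x) <= C * rho ^+ M * fnorm q x.

Section Maximizer.
Variables (rho : R) (T : oper).
Hypotheses (rho0 : 0 <= rho) (rho1 : rho < 1) (Tdecay : decay rho T).

Lemma decay_sub x y : T (x - y) = T x - T y.
Proof.
by case: Tdecay => TD _; rewrite addrC -scaleN1r TD scaleN1r addrC.
Qed.

(* Weak compactness of the unit ball; [T] is weak-to-norm continuous on it, being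
   a norm limit of the finite rank operators [T \o trunc M]. *)
Lemma decay_maximizer (us : seq vec) : (forall u, u \in us -> fock q u) ->
  exists x, [/\ fock q x, fnorm q x <= 1, forall u, u \in us -> fip q x u = 0 &
    forall y, fock q y -> fnorm q y <= 1 ->
      (forall u, u \in us -> fip q y u = 0) -> fnorm q (T y) <= fnorm q (T x)].
Proof.
move=> usf; have [TD [C C0 TC]] := Tdecay.
pose ball y := [/\ fock q y, fnorm q y <= 1 & forall u, u \in us -> fip q y u = 0].
have Tf y : fock q y -> fock q (T y) /\ fnorm q (T y) <= C * fnorm q y.
  by move=> fy; have := TC 0%N y fy; rewrite expr0 mulr1; apply.
pose E := [set fnorm q (T y) | y in ball].
have fip0 u : u \in us -> fip q 0 u = 0.
  by move=> uu; have := fipBl hq (usf _ uu) (usf _ uu) (usf _ uu); rewrite !subrr.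
have Esup : has_sup E.
  split.
    exists (fnorm q (T 0)), 0 => //; split=> //; first exact: fock0.
    have := fnormZ hq 0 (fock0 (d := d) hq); rewrite scaler0 normr0 mul0r.
    by move=> /complexI ->.
  exists C => _ [y [fy y1 _] <-]; apply: (le_trans (proj2 (Tf y fy))).
  by rewrite ler_piMr.
have approx k : exists y, ball y /\ sup E - k.+1%:R^-1 < fnorm q (T y).
  have [|_ [y By <-] hy] := @sup_adherent _ E (k.+1%:R^-1) _ Esup.
    by rewrite invr_gt0 ltr0n.
  by exists y.
have {approx}[z zP] := choice approx.
have [U [UU Uoo]] := @ultraFilterLemma nat \oo _.
have zf k : fock q (z k) by case: (zP k) => -[].
have z1 k : fnorm q (z k) <= 1 by case: (zP k) => -[].
have [x [fx x1 xz]] := bounded_cvg_coord UU (fun k => conj (zf k) (z1 k)).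
have tr M : fnorm q (trunc M (z k - x)) @[k --> U] --> (0 : R).
  exact: cvg_coord_trunc_sub.
have fzx k : fock q (z k - x) by apply: (fockB hq).
have zx2 k : fnorm q (z k - x) <= 2.
  by apply: (le_trans (fnormB hq (zf k) fx)); have := z1 k; lra.
exists x; split=> //.
- move=> u uu; have fu := usf u uu; apply/eqP; rewrite -normr_le0.
  suff h e : 0 < e -> `|fip q x u| <= e%:C.
    have : complex.Re `|fip q x u| <= 0.
      apply/ler_addgt0Pl => e e0; rewrite addr0.
      by have := h e e0; rewrite lecE => /andP[].
    by rewrite -lecR RRe_real // normr_real.
  move=> e0.
  (* The tail of [u] is paired with a vector of norm at most 2, so it contributes at most [e / 2];
     the low degrees contribute the other half. *)
  have e4 : 0 < e / 4 by lra.
  have := sub_trunc_cvg0 hq fu => /cvgr0Pnorm_lt /(_ _ e4) [M _ /(_ M (leqnn M)) /=].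
  rewrite ger0_norm ?fnorm_ge0 // => uM.
  have k0 : 0 < e / 2 / (fnorm q u + 1).
    by rewrite !divr_gt0 // ltr_wpDl ?fnorm_ge0.
  have /filter_ex[k] :
      U [set k | fnorm q (trunc M (z k - x)) < e / 2 / (fnorm q u + 1)].
    have /cvgr0Pnorm_lt/(_ _ k0) := tr M; apply: filterS => k /=.
    by rewrite ger0_norm ?fnorm_ge0.
  rewrite /= => kM.
  have [[_ _ /(_ u uu) zu] _] := zP k.
  have [ft1 ft2] := (proj1 (trunc_fock hq M u), proj1 (trunc_fock hq M (z k - x))).
  have -> : fip q x u = - (fip q (trunc M (z k - x)) (trunc M u)
                           + fip q (z k - x) (u - trunc M u)).
    by rewrite -fip_trunc_r (fipBr hq) // addrC subrK (fipBl hq) // zu sub0r opprK.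
  rewrite normrN; apply: le_trans (ler_normD _ _) _.
  have -> : e = e / 2 + e / 2 by field.
  rewrite real_complexD; apply: lerD.
    apply: le_trans (fip_cauchy_schwarz hq ft2 ft1) _; rewrite lecR.
    have := kM; rewrite ltr_pdivlMr ?ltr_wpDl ?fnorm_ge0 // => /ltW; apply: le_trans.
    rewrite ler_wpM2l ?fnorm_ge0 //; apply: (le_trans (fnorm_trunc_le hq M fu)); lra.
  have fuM := @sub_trunc_fock _ _ _ hq M _ fu.
  have csu := fip_cauchy_schwarz hq (fzx k) fuM; apply: (le_trans csu).
  rewrite lecR; have := zx2 k; have := fnorm_ge0 q (u - trunc M u).
  have := fnorm_ge0 q (z k - x); nra.
- move=> y fy y1 yu.
  have ySup : fnorm q (T y) <= sup E by apply: sup_upper_bound => //; exists y.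
  apply: (le_trans ySup); apply/ler_addgt0Pl => e e0.
  have geo : (fun M => C * rho ^+ M) @ \oo --> (0 : R).
    by rewrite -(mulr0 C); apply: cvgMr; apply: cvg_expr; rewrite ger0_norm.
  (* Against a vector of norm at most 2 this bounds the image of the high degrees by [e / 4]. The
     low degrees and the defect of [z k] from the supremum cost [e / 4] each. *)
  have e4 : 0 < e / 8 by lra.
  move/cvgr0Pnorm_lt : geo => /(_ _ e4) [M _ /(_ M (leqnn M)) /=].
  rewrite ger0_norm ?mulr_ge0 ?exprn_ge0 // => CM.
  have k0 : 0 < e / 4 / (C + 1) by rewrite !divr_gt0 // ltr_wpDl.
  have U1 : U [set k | fnorm q (trunc M (z k - x)) < e / 4 / (C + 1)].
    have /cvgr0Pnorm_lt/(_ _ k0) := tr M; apply: filterS => k /=.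
    by rewrite ger0_norm ?fnorm_ge0.
  have U2 : U [set k | k.+1%:R^-1 < e / 4].
    apply: Uoo; have /cvgr0Pnorm_lt/(_ (e / 4)) := @cvg_harmonic R.
    have e4' : 0 < e / 4 by lra.
    move=> /(_ e4'); apply: filterS => k /=; rewrite ger0_norm //.
  have U12 := @filterI _ U _ _ _ U1 U2; have [k /= [kM ke]] := filter_ex (U12 _).
  have [_ zsup] := zP k.
  have ft := proj1 (trunc_fock hq M (z k - x)).
  have fs := @sub_trunc_fock _ _ _ hq M _ (fzx k).
  have [fT1 h1] := Tf _ ft.
  have [fT2 h2] := TC M _ fs (@low_sub_trunc _ _ M (z k - x)).
  have h3 : fnorm q (T (z k)) <= fnorm q (T x) + fnorm q (T (z k - x)).
    have -> : T (z k) = T x + T (z k - x) by rewrite decay_sub addrC subrK.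
    by apply: (fnormD hq); [exact: (proj1 (Tf _ fx)) | exact: (proj1 (Tf _ (fzx k)))].
  have h4 : fnorm q (T (z k - x)) <= fnorm q (T (trunc M (z k - x)))
      + fnorm q (T ((z k - x) - trunc M (z k - x))).
    have -> : T (z k - x) = T (trunc M (z k - x)) + T ((z k - x) - trunc M (z k - x)).
      by rewrite [X in _ = _ + X]decay_sub [RHS]addrC subrK.
    exact: (fnormD hq).
  have h5 := fnorm_sub_trunc_le hq M (fzx k).
  have h6 := zx2 k; have h7 := fnorm_ge0 q (z k - x - trunc M (z k - x)).
  have h8 : fnorm q (T (trunc M (z k - x))) <= e / 4.
    apply: (le_trans h1); have := kM; rewrite ltr_pdivlMr ?ltr_wpDl // => /ltW.
    by apply: le_trans; rewrite mulrC ler_wpM2l ?fnorm_ge0 //; lra.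
  have h9 : fnorm q (T (z k - x - trunc M (z k - x))) <= e / 4.
    by apply: (le_trans h2); nra.
  by move: h3 h4 h8 h9 ke zsup; move: (k.+1%:R^-1) => r; lra.
Qed.

End Maximizer.
End WeakCompactness.

(** * From decay along the degree to Schatten classes *)

Section Schatten.
Variables (R : realType) (d : nat) (q : R) (hq : -1 < q < 1).
Local Notation vec := (vec R d).
Local Notation oper := (oper R d).
Local Notation V := (fockT d hq).

Definition fcoord (w : seq 'I_d) (x : V) : R[i] := fval x w.

Lemma fcoord_is_scalar w : scalar (fcoord w). Proof. by []. Qed.

HB.instance Definition _ w :=
  GRing.isLinear.Build R[i] V R[i] *%R (fcoord w) (fcoord_is_scalar w).

Definition short_words M : seq (seq 'I_d) :=
  flatten [seq [seq val t | t <- enum {: k.-tuple 'I_d}] | k <- iota 0 M].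

(** [maxn d 1] gives the same count for positive [d], and for [d = 0] it keeps [block M] at least
    [M]. *)
Lemma size_short_words M : (size (short_words M) <= block (maxn d 1) M)%N.
Proof.
rewrite size_flatten /shape -map_comp sumnE big_map /block.
rewrite -(big_mkord xpredT (fun k => maxn d 1 ^ k)%N).
rewrite /index_iota subn0; apply: leq_sum => k _.
rewrite /= size_map -cardE card_tuple card_ord.
by case: k => [|k] //; rewrite leq_exp2r // leq_maxl.
Qed.

Lemma mem_short_words M w : (size w < M)%N -> w \in short_words M.
Proof.
move=> wM; apply/flattenP; exists [seq val t | t <- enum {: (size w).-tuple 'I_d}].
  by apply/mapP; exists (size w); rewrite // mem_iota.
by apply/mapP; exists (in_tuple w); rewrite // mem_enum.
Qed.

Variables (rho : R) (T : oper).
Hypotheses (rho0 : 0 <= rho) (rho1 : rho < 1) (Tdecay : decay q rho T).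

Lemma decay_fock x : fock q x -> fock q (T x).
Proof.
by move=> fx; case: Tdecay => _ [C _ TC]; exact: (proj1 (TC 0%N x fx _)).
Qed.

Definition fock_lift (x : V) : V := FockT hq (decay_fock (fval_fock x)).

Lemma fock_lift_is_linear : linear fock_lift.
Proof. by move=> c x y; apply: fval_inj; exact: (proj1 Tdecay). Qed.

HB.instance Definition _ :=
  GRing.isLinear.Build R[i] V V *:%R fock_lift fock_lift_is_linear.

Lemma decay_bounded_op : bounded_op q T.
Proof.
case: Tdecay => TD [C C0 TC]; split=> [x fx|c x y _ _|]; first exact: decay_fock.
  exact: TD.
exists C => x fx; have [|_] := TC 0%N x fx; first by [].
by rewrite expr0 mulr1.
Qed.

Lemma fval_sum (I : Type) (r : seq I) (F : I -> V) :
  fval (\sum_(i <- r) F i) = \sum_(i <- r) fval (F i).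
Proof. by elim/big_rec2: _ => // i x y _ <-. Qed.

Lemma schatten_of_decay (p : \bar R) : (1 <= p)%E ->
  (forall r, p = r%:E -> (maxn d 1)%:R * rho `^ r < 1) -> schatten q p T.
Proof.
move=> p1 hp; split; first exact: decay_bounded_op.
have [TD [C C0 TC]] := Tdecay.
have maxT : forall us : seq V, exists x : V,
  [/\ hn (@fform R d q hq) x <= 1, forall u, u \in us -> fform x u = 0 &
      forall y, hn (@fform R d q hq) y <= 1 ->
        (forall u, u \in us -> fform y u = 0) ->
        hn (@fform R d q hq) (fock_lift y) <= hn (@fform R d q hq) (fock_lift x)].
  move=> us; have [|x [fx x1 xu xm]] :=
    @decay_maximizer R d q hq rho T rho0 rho1 Tdecay [seq fval u | u <- us].
    by move=> _ /mapP[u _ ->]; exact: fval_fock.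
  exists (FockT hq fx); split; first by rewrite hn_fform.
    by move=> u uu; apply: xu; exact: map_f.
  move=> y; rewrite !hn_fform => y1 yu; apply: xm => //; first exact: fval_fock.
  by move=> _ /mapP[u uu ->]; exact: yu.
have FD := @fformDl R d q hq; have FC := @fformC R d q hq.
have F0 := @fform_ge0 R d q hq; have Fe := @fform_eq0 R d q hq.
have [u uP] := singular_vectors_exist FD FC F0 Fe maxT.
pose s n := hn (@fform R d q hq) (fock_lift (u n)).
(* Where [s n] vanishes, [0^-1 = 0] makes [v n] zero; no orthonormality is asked for there. *)
pose v n := fval ((s n)^-1%:C *: fock_lift (u n)).
have s0 n : 0 <= s n by exact: hn_ge0.
have snd i j : (i <= j)%N -> s j <= s i.
  exact: (singular_nonincreasing FD FC uP).
(* The linear conditions are the coordinates at the short words. Indices past the end of the list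
   fall on the default [[::]] and merely repeat the vacuum coordinate. *)
have sblock M : s (block (maxn d 1) M) <= C * rho ^+ M.
  apply: (@singular_value_le _ _ _ FD FC F0 fock_lift u uP _
    (fun i : 'I__ => fcoord (nth [::] (short_words M) i))) => [|x xw].
    by rewrite mulr_ge0 ?exprn_ge0.
  rewrite !hn_fform; apply: (proj2 (TC M _ (fval_fock x) _)) => w wM.
  have /nthP-/(_ [::])[k ks <-] := mem_short_words wM.
  have kb := leq_trans ks (size_short_words M).
  exact: (xw (Ordinal kb)).
have sv n : (s n)%:C *: v n = T (fval (u n)).
  have [sn0|sn0] := eqVneq (s n) 0.
    rewrite sn0 scale0r; have := hn_eq0 F0 Fe sn0.
    by move=> /(congr1 (@fval R d q hq)).
  by rewrite /v /= scalerA -real_complexM mulfV // scale1r.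
exists s, (fun n => fval (u n)), v; split; last first.
  case: p p1 hp => [r|//|//] p1 hp; last first.
    exact: (@block_cvg0 R (maxn d 1) s C rho).
  apply: (@block_summable R (maxn d 1) s C rho) => //.
  - by rewrite leq_max orbT.
  - by rewrite (lt_le_trans ltr01) // -lee_fin.
  - exact: hp.
split=> // [n|m n sm sn|x fx].
- by split; exact: fval_fock.
- have orth : fform (u m) (u n) = (m == n)%:R.
    have [->|mn] := eqVneq m n; last exact: (singular_orthogonal FC uP).
    rewrite (form_hn F0) (singular_unit FD uP) ?expr1n //.
  split; first exact: orth.
  have -> : fip q (v m) (v n)
      = fform ((s m)^-1%:C *: fock_lift (u m)) ((s n)^-1%:C *: fock_lift (u n)).
    by [].
  rewrite (formZl FD) (formZr FD FC) conjC_real.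
  have [->|mn] := eqVneq m n.
    rewrite (form_hn F0) -/(s n) -!real_complexM mulrA -expr2 -exprMn mulVf //.
    by rewrite expr1n.
  have [mn'|mn'] := ltnP m n.
    rewrite FC (singular_image_orthogonal FD FC F0 uP mn') rmorph0 !mulr0 //.
  have nm : (n < m)%N by rewrite ltn_neqAle eq_sym mn.
  by rewrite (singular_image_orthogonal FD FC F0 uP nm) !mulr0.
pose x' := FockT hq fx.
have rem N : fnorm q (T x - \sum_(n < N) ((s n)%:C * fip q x (fval (u n))) *: v n)
    <= s N * fnorm q x.
  have := svd_remainder FD FC F0 uP N x'; rewrite !hn_fform.
  rewrite linearB linear_sum /=; congr (fnorm q _ <= _).
  congr (T x - _); rewrite fval_sum; apply: eq_bigr => n _.
  by rewrite linearZ /= [_%:C * _]mulrC -scalerA sv.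
have s_cvg : (fun N => s N * fnorm q x) @ \oo --> (0 : R).
  rewrite -(mul0r (fnorm q x)); apply: cvgMl.
  exact: (@block_cvg0 R (maxn d 1) s C rho).
apply: (@squeeze_cvgr _ _ _ _ (fun=> 0) (fun N => s N * fnorm q x)).
- by apply: nearW => N; rewrite fnorm_ge0 rem.
- exact: cvg_cst.
- exact: s_cvg.
Qed.

End Schatten.

(** * Left and right field operators *)

Section BandOperators.
Variables (R : realType) (d : nat) (q : R) (hq : -1 < q < 1).
Local Notation vec := (vec R d).
Local Notation oper := (oper R d).
Implicit Types (x y z : vec) (w : seq 'I_d) (S T : oper).

Definition lin T := forall (c : R[i]) x y, T (c *: x + y) = c *: T x + T y.

Lemma linD T : lin T -> forall x y, T (x + y) = T x + T y.
Proof. by move=> TD x y; rewrite -[x]scale1r TD !scale1r. Qed.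

Lemma lin0 T : lin T -> T 0 = 0.
Proof. by move=> TD; have := TD (-1) 0 0; rewrite scaler0 addr0 scaleN1r addNr. Qed.

Lemma linZ T : lin T -> forall (c : R[i]) x, T (c *: x) = c *: T x.
Proof. by move=> TD c x; rewrite -[c *: x]addr0 TD lin0 // addr0. Qed.

Lemma linB T : lin T -> forall x y, T (x - y) = T x - T y.
Proof. by move=> TD x y; rewrite addrC -scaleN1r TD scaleN1r addrC. Qed.

Definition bounded T := exists2 C : R, 0 <= C &
  forall x, fock q x -> fock q (T x) /\ fnorm q (T x) <= C * fnorm q x.

Definition fin x := exists M, forall w, (M <= size w)%N -> x w = 0.

Definition lowers_by K T := forall M x, low M x -> low (M - K) (T x).

(** [band_low] controls the loss of decay when the operator is composed on the right; [band_fin]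
    keeps vectors in a space where the number operator causes no divergence. *)
Record band T : Prop := Band {
  band_lin : lin T;
  band_bounded : bounded T;
  band_low : exists K, lowers_by K T;
  band_fin : forall x, fin x -> fin (T x) }.

Lemma band_id : band id.
Proof.
split=> //; first by exists 1 => // x fx; rewrite mul1r.
by exists 0%N => M x h; rewrite subn0.
Qed.

Lemma lin_comp S T : lin S -> lin T -> lin (S \o T).
Proof. by move=> SD TD c x y; rewrite /= TD SD. Qed.

Lemma lin_add S T : lin S -> lin T -> lin (S + T).
Proof.
move=> SD TD c x y; rewrite -[LHS]/(S _ + T _) SD TD scalerDr.
by rewrite addrACA.
Qed.

Lemma lin_scale (c : R[i]) S : lin S -> lin (c *: S).
Proof.
move=> SD e x y; rewrite -[LHS]/(c *: S _) SD scalerDr.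
by rewrite -[(c *: S) x]/(c *: S x) !scalerA [e * c]mulrC.
Qed.

Lemma bounded_comp S T : bounded S -> bounded T -> bounded (S \o T).
Proof.
move=> [C C0 SC] [D D0 TD]; exists (C * D) => [|x fx]; first exact: mulr_ge0.
have [fT h1] := TD x fx; have [fS h2] := SC _ fT; split=> //.
by apply: (le_trans h2); rewrite -mulrA ler_wpM2l.
Qed.

Lemma bounded_add S T : bounded S -> bounded T -> bounded (S + T).
Proof.
move=> [C C0 SC] [D D0 TD]; exists (C + D) => [|x fx]; first exact: addr_ge0.
have [fS h1] := SC x fx; have [fT h2] := TD _ fx.
split; first exact: (fockD hq).
by apply: (le_trans (fnormD hq fS fT)); rewrite mulrDl lerD.
Qed.

Lemma bounded_scale (c : R[i]) S : bounded S -> bounded (c *: S).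
Proof.
move=> [C C0 SC]; exists (complex.Re `|c| * C) => [|x fx].
  by rewrite mulr_ge0 // -ler0c RRe_real // normr_real.
have [fS h1] := SC x fx; split; first exact: (fockZ hq).
rewrite -lecR fnormZ // -mulrA real_complexM RRe_real ?normr_real //.
by rewrite ler_wpM2l // lecR.
Qed.

Lemma lowers_add K L S T : lowers_by K S -> lowers_by L T ->
  lowers_by (maxn K L) (S + T).
Proof.
move=> SK TL M x h w wM; rewrite -[LHS]/(S x w + T x w).
by rewrite (SK _ _ h) ?(TL _ _ h) ?addr0 //; apply: (leq_trans wM);
   apply: leq_sub2l; rewrite leq_max leqnn ?orbT.
Qed.

Lemma lowers_comp K L S T : lowers_by K S -> lowers_by L T ->
  lowers_by (L + K) (S \o T).
Proof. by move=> SK TL M x h; rewrite subnDA; apply: SK; exact: TL. Qed.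

Lemma lowers_scale (c : R[i]) K S : lowers_by K S -> lowers_by K (c *: S).
Proof.
by move=> SK M x h w wM; rewrite -[LHS]/(c * S x w) (SK _ _ h) ?mulr0.
Qed.

Lemma fin_add x y : fin x -> fin y -> fin (x + y).
Proof.
move=> [M xM] [N yN]; exists (maxn M N) => w wMN.
by rewrite vecDE xM ?yN ?addr0 //; apply: leq_trans wMN;
   rewrite leq_max leqnn ?orbT.
Qed.

Lemma fin_scale (c : R[i]) x : fin x -> fin (c *: x).
Proof. by move=> [M xM]; exists M => w wM; rewrite vecZE xM ?mulr0. Qed.

Lemma band_comp S T : band S -> band T -> band (S \o T).
Proof.
move=> [SD Sb [K SK] Sf] [TD Tb [L TL] Tf]; split.
- exact: lin_comp.
- exact: bounded_comp.
- by exists (L + K)%N; exact: lowers_comp.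
- by move=> x fx; apply: Sf; exact: Tf.
Qed.

Lemma band_add S T : band S -> band T -> band (S + T).
Proof.
move=> [SD Sb [K SK] Sf] [TD Tb [L TL] Tf]; split.
- exact: lin_add.
- exact: bounded_add.
- by exists (maxn K L); exact: lowers_add.
- by move=> x fx; apply: fin_add; [exact: Sf | exact: Tf].
Qed.

Lemma band_scale (c : R[i]) S : band S -> band (c *: S).
Proof.
move=> [SD Sb [K SK] Sf]; split.
- exact: lin_scale.
- exact: bounded_scale.
- by exists K; exact: lowers_scale.
- by move=> x fx; apply: fin_scale; exact: Sf.
Qed.

Lemma bounded_of_nsq T (C : R) : 0 <= C ->
  (forall x, fock q x -> forall n, series (level q (T x)) n <= C * nsq q x) ->
  bounded T.
Proof.
move=> C0 h; exists (Num.sqrt C) => [|x fx]; first exact: sqrtr_ge0.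
have [f l] := fock_bounded hq (h x fx); split=> //.
by rewrite !fnormE -sqrtrM // ler_sqrt // mulr_ge0 ?(nsq_ge0 hq).
Qed.

Let C0 := ltW (cr_const_gt0 hq).

Lemma band_cr i : band (cr i).
Proof.
split; first exact: crD.
- apply: (@bounded_of_nsq _ (cr_const q)) => // x fx [|n].
    by rewrite /series /= big_geq // mulr_ge0 // (nsq_ge0 hq).
  rewrite /series /= big_nat_recl // {1}/level ipq0_cr add0r.
  apply: (@le_trans _ _ (cr_const q * series (level q x) n)).
    by rewrite /series /= mulr_sumr; apply: ler_sum => k _; exact: cr_level_le.
  by rewrite ler_wpM2l // series_le_nsq.
- exists 0%N => M x h [|j w] wM; first by [].
  by move: wM; rewrite subn0 cr_cons => wM; rewrite h ?mulr0 //; exact: ltnW.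
- move=> x [M xM]; exists M.+1 => -[|j w] wM //.
  by rewrite cr_cons xM ?mulr0.
Qed.

Lemma band_an i : band (an q i).
Proof.
split; first exact: anD.
- apply: (@bounded_of_nsq _ (cr_const q)) => // x fx n.
  apply: (@le_trans _ _ (cr_const q * series (level q x) n.+1)).
    rewrite /series /= big_nat_recl // mulrDr.
    rewrite -[leLHS]add0r lerD ?mulr_ge0 ?level_ge0 //.
    by rewrite mulr_sumr; apply: ler_sum => k _; exact: an_level_le.
  by rewrite ler_wpM2l // series_le_nsq.
- exists 1%N => M x h w wM; rewrite /an big1 // => k _.
  by rewrite h ?mulr0 // size_ins; move: wM; lia.
- move=> x [M xM]; exists M => w wM; rewrite /an big1 // => k _.
  by rewrite xM ?mulr0 // size_ins leqW.
Qed.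

Lemma band_flip : band (@flip R d).
Proof.
split=> //.
- apply: (@bounded_of_nsq _ 1) => // x fx n; rewrite mul1r.
  suff -> : level q (flip x) = level q x by exact: series_le_nsq.
  by apply/funext => k; rewrite /level ipq_flip.
- by exists 0%N => M x h w; rewrite subn0 => wM; apply: h; rewrite size_rev.
- by move=> x [M xM]; exists M => w wM; apply: xM; rewrite size_rev.
Qed.

Definition gen i : oper := cr i + an q i.
Definition rgen i : oper := rcr i + ran q i.

Lemma genE i x : gen i x = cr i x + an q i x. Proof. by []. Qed.
Lemma rgenE i x : rgen i x = rcr i x + ran q i x. Proof. by []. Qed.

Lemma band_gen i : band (gen i).
Proof. by apply: band_add; [exact: band_cr | exact: band_an]. Qed.

Lemma band_rgen i : band (rgen i).
Proof.
by apply: band_add; apply: band_comp; do ?[exact: band_flip]; apply: band_comp;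
   do ?[exact: band_flip]; [exact: band_cr | exact: band_an].
Qed.

Lemma flip_gen i : flip \o gen i \o flip = rgen i.
Proof. by apply/funext. Qed.

(** The commutators of [cr i] with [ran j] and of [an i] with [rcr j] are opposite multiples of [qN]
    and cancel. *)
Lemma gen_rgen i j x : gen i (rgen j x) = rgen j (gen i x).
Proof.
rewrite !genE !rgenE (linD (@crD _ _ i)) (linD (@anD _ _ q i)).
rewrite (linD (@rcrD _ _ j)) (linD (@ranD _ _ q j)).
rewrite cr_rcr (cr_ran q) an_rcr (an_ran hq).
by apply/funext => w; rewrite !(vecDE, vecNE, vecZE); ring.
Qed.

(** The closure rules of [Aq] without the star, since the generators are self-adjoint. The parameter
    [g] serves the left and the right field operators alike. *)
Inductive poly (g : 'I_d -> oper) : oper -> Prop :=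
| poly_gen i : poly g (g i)
| poly_one : poly g id
| poly_add a b : poly g a -> poly g b -> poly g (a + b)
| poly_scale (c : R[i]) a : poly g a -> poly g (c *: a)
| poly_mul a b : poly g a -> poly g b -> poly g (a \o b).

Lemma poly_sum g (I : Type) (r : seq I) (F : I -> oper) :
  (forall i, poly g (F i)) -> poly g (\sum_(i <- r) F i).
Proof.
move=> h; elim: r => [|i r IHr]; last by rewrite big_cons; exact: poly_add.
by rewrite big_nil -(scale0r (id : oper)); apply: poly_scale; exact: poly_one.
Qed.

Lemma poly_band g a : (forall i, band (g i)) -> poly g a -> band a.
Proof.
move=> gb; elim=> // [|b c _ hb _ hc|c b _ hb|b c _ hb _ hc].
- exact: band_id.
- exact: band_add.
- exact: band_scale.
- exact: band_comp.
Qed.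

Lemma poly_gen_band a : poly gen a -> band a.
Proof. by apply: poly_band; exact: band_gen. Qed.

Lemma poly_rgen_band a : poly rgen a -> band a.
Proof. by apply: poly_band; exact: band_rgen. Qed.

Lemma poly_comm a b x : poly gen a -> poly rgen b -> a (b x) = b (a x).
Proof.
move=> ha; elim: ha b x => {a} [i|//|a a' _ h _ h'|c a _ h|a a' _ h _ h'] b x hb.
- elim: hb x => {b} [j|//|b b' _ h _ h'|c b _ h|b b' _ h _ h'] x.
  + exact: gen_rgen.
  + rewrite -[(b + b') x]/(b x + b' x) (linD (band_lin (band_gen i))) h h'.
    by [].
  + rewrite -[(c *: b) x]/(c *: b x) (linZ (band_lin (band_gen i))) h.
    by [].
  + by rewrite /= h h'.
- rewrite -[LHS]/(a (b x) + a' (b x)) h // h' //.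
  by rewrite -(linD (band_lin (poly_rgen_band hb))).
- rewrite -[LHS]/(c *: a (b x)) h //.
  by rewrite -(linZ (band_lin (poly_rgen_band hb))).
- by rewrite /= h' // h.
Qed.

Lemma poly_flip a : poly gen a -> poly rgen (flip \o a \o flip).
Proof.
elim=> {a} [i||a b _ ha _ hb|c a _ ha|a b _ ha _ hb].
- by rewrite flip_gen; exact: poly_gen.
- have -> : flip \o id \o flip = id :> oper by apply/funext => x; rewrite /= flipK.
  exact: poly_one.
- exact: (poly_add ha hb).
- exact: (poly_scale c ha).
- have -> : flip \o (a \o b) \o flip
      = (flip \o a \o flip) \o (flip \o b \o flip) :> oper.
    by apply/funext => x; rewrite /= flipK.
  exact: (poly_mul ha hb).
Qed.

Local Notation Omega := (@vacuum R d).

(** This builds $W_q(y)$ by induction on the degree. Sorting words by their first letter writes [y]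
    as a multiple of the vacuum plus vectors [cr i z], and [cr i z] is [gen i z - an q i z], where
    both [z] and [an q i z] have smaller degree. *)
Lemma fin_poly_vacuum y : fin y -> exists a, poly gen a /\ a Omega = y.
Proof.
case=> M; elim: M y => [|M IHM] y yM.
  exists (0 *: id); split; first by apply: poly_scale; exact: poly_one.
  by rewrite -[LHS]/(0 *: Omega) scale0r; apply/funext => w; rewrite yM.
pose tl i : vec := fun w => y (i :: w).
have hcr i : exists a, poly gen a /\ a Omega = cr i (tl i).
  have [|a [pa aO]] := IHM (tl i); first by move=> w wM; exact: yM.
  have [|b [pb bO]] := IHM (an q i (tl i)).
    move=> w wM; rewrite /an big1 // => k _.
    by rewrite /tl yM ?mulr0 //= size_ins ltnS leqW.
  exists ((gen i \o a) + (-1) *: b); split.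
    by apply: poly_add; [apply: poly_mul => //; exact: poly_gen | exact: poly_scale].
  rewrite -[LHS]/(gen i (a Omega) + -1 *: b Omega) aO bO genE scaleN1r.
  by rewrite addrK.
have [f fP] := choice hcr; exists (y [::] *: id + \sum_i f i); split.
  apply: poly_add; first by apply: poly_scale; exact: poly_one.
  by apply: poly_sum => i; exact: (proj1 (fP i)).
have -> : (y [::] *: id + \sum_i f i) Omega
    = y [::] *: Omega + \sum_i cr i (tl i).
  rewrite -[LHS]/(y [::] *: Omega + (\sum_i f i) Omega); congr (_ + _).
  rewrite (big_morph (fun S : oper => S Omega) (id1 := 0) (op1 := +%R)) //.
  by apply: eq_bigr => i _; exact: (proj2 (fP i)).
apply/funext => w; rewrite vecDE vecZE.
rewrite (big_morph (fun x : vec => x w) (id1 := 0) (op1 := +%R)) //.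
case: w => [|j w]; first by rewrite /vacuum eqxx mulr1 big1 ?addr0.
rewrite /vacuum /= mulr0 add0r (bigD1 j) //= cr_cons eqxx mul1r big1 ?addr0 //.
by move=> i ij; rewrite cr_cons eq_sym (negPf ij) mul0r.
Qed.

Lemma fin_rpoly_vacuum y : fin y -> exists b, poly rgen b /\ b Omega = y.
Proof.
move=> fy; have [a [pa ay]] := fin_poly_vacuum (band_fin band_flip fy).
exists (flip \o a \o flip); split; first exact: poly_flip.
have fO : flip Omega = Omega.
  apply/funext => w; rewrite /flip /vacuum; congr ((_ : bool)%:R).
  by rewrite -!size_eq0 size_rev.
by rewrite /= fO ay flipK.
Qed.

End BandOperators.

(** * Decay of the double commutator *)

Section Commutators.
Variables (R : realType) (d : nat) (q : R) (hq : -1 < q < 1).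
Local Notation vec := (vec R d).
Local Notation oper := (oper R d).
Implicit Types (x y z : vec) (w : seq 'I_d) (S T : oper).

(** The bound on lowering is recorded because a factor $e^{-tN}$ on the left acts according to the
    degree of the image. *)
Definition band_decay (rho : R) T :=
  decay q rho T /\ exists K, lowers_by K T.

Lemma eq_band_decay rho S T : S =1 T -> band_decay rho S -> band_decay rho T.
Proof. by move=> /funext ->. Qed.

Lemma band_decay0 rho : 0 <= rho -> band_decay rho (fun=> 0).
Proof.
move=> rho0; split; last by exists 0%N.
split=> [c x y|]; first by rewrite scaler0 addr0.
exists 0 => // M x fx _; split; first exact: (fock0 hq).
have := fnormZ hq 0 (fock0 (d := d) hq); rewrite scaler0 normr0 mul0r.
by move=> /complexI ->; rewrite !mul0r.
Qed.

Lemma band_decay_add rho S T : 0 <= rho ->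
  band_decay rho S -> band_decay rho T -> band_decay rho (S + T).
Proof.
move=> rho0 [[SD [C C0 SC]] [K SK]] [[TD [D D0 TC]] [L TL]].
split; last by exists (maxn K L); exact: lowers_add.
split; first exact: lin_add.
exists (C + D) => [|M x fx xM]; first exact: addr_ge0.
have [fS h1] := SC M x fx xM; have [fT h2] := TC M x fx xM.
split; first exact: (fockD hq).
by apply: (le_trans (fnormD hq fS fT)); rewrite !mulrDl lerD.
Qed.

Lemma band_decay_comp_l rho S T :
  band q S -> band_decay rho T -> band_decay rho (S \o T).
Proof.
move=> [SD [C C0 SC] [K SK] _] [[TD [D D0 TC]] [L TL]].
split; last by exists (L + K)%N; exact: lowers_comp.
split; first exact: lin_comp.
exists (C * D) => [|M x fx xM]; first exact: mulr_ge0.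
have [fT h1] := TC M x fx xM; have [fS h2] := SC _ fT; split=> //.
apply: (le_trans h2).
have -> : C * D * rho ^+ M * fnorm q x = C * (D * rho ^+ M * fnorm q x) by ring.
by rewrite ler_wpM2l.
Qed.

(** For [M < K] the truncated difference is 0, and $\rho^{-K}\rho^M\ge1$ still dominates. *)
Lemma expr_subn_le (rho : R) M K : 0 < rho -> rho <= 1 ->
  rho ^+ (M - K) <= rho ^- K * rho ^+ M.
Proof.
move=> rho0 rho1; have [KM|/ltnW MK] := leqP K M.
  by rewrite -[in leRHS](subnKC KM) exprD mulKf // expf_neq0 // gt_eqF.
rewrite (eqP (_ : M - K == 0)%N) ?subn_eq0 // expr0.
rewrite -[in leRHS](subnKC MK) exprD invfM mulrAC mulVf ?expf_neq0 ?gt_eqF //.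
by rewrite mul1r invf_ge1 ?exprn_gt0 // exprn_ile1 // ltW.
Qed.

(** [T] sends degree at least [M] to degree at least [M - L], which costs the constant factor
    [rho ^- L]. *)
Lemma band_decay_comp_r rho S T : 0 < rho -> rho <= 1 ->
  band_decay rho S -> band q T -> band_decay rho (S \o T).
Proof.
move=> rho0 rho1 [[SD [C C0 SC]] [K SK]] [TD [D D0 TC] [L TL] _].
split; last by exists (L + K)%N; exact: lowers_comp.
split; first exact: lin_comp.
exists (C * rho ^- L * D) => [|M x fx xM].
  by rewrite !mulr_ge0 // invr_ge0 exprn_ge0 // ltW.
have [fT h1] := TC x fx; have [fS h2] := SC _ _ fT (TL _ _ xM); split=> //.
apply: (le_trans h2).
apply: (@le_trans _ _ (C * (rho ^- L * rho ^+ M) * (D * fnorm q x))); last first.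
  by rewrite le_eqVlt; apply/orP; left; apply/eqP; ring.
apply: ler_pM => //; last 1 first.
- by rewrite ler_wpM2l // expr_subn_le.
- by rewrite mulr_ge0 // exprn_ge0 // ltW.
- exact: fnorm_ge0.
Qed.

Lemma band_decay_scale rho (c : R[i]) S :
  band_decay rho S -> band_decay rho (c *: S).
Proof.
move=> hS; apply: (@eq_band_decay _ ((c *: id : oper) \o S)) => //.
by apply: band_decay_comp_l hS; apply: (band_scale hq); exact: band_id.
Qed.

(** A common estimate for the diagonal operators $q^N$ and $e^{-tN}$. *)
Lemma diag_low (f : nat -> R) (rho : R) M x : 0 <= rho -> rho <= 1 ->
  (forall n, `|f n| <= rho ^+ n) -> fock q x -> low M x ->
  fock q (fun w => (f (size w))%:C * x w) /\
  fnorm q (fun w => (f (size w))%:C * x w) <= rho ^+ M * fnorm q x.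
Proof.
move=> rho0 rho1 hf fx xM; set y := fun w => _.
have lev n : level q y n <= (rho ^+ M) ^+ 2 * level q x n.
  have [nM|Mn] := ltnP n M.
    have -> : level q y n = 0.
      rewrite /level (@eq_ipq _ _ _ n y 0 y 0) ?ipq0l // => v;
      by rewrite /y xM ?mulr0 // size_tuple.
    by rewrite mulr_ge0 ?level_ge0 // sqr_ge0.
  have -> : level q y n = f n ^+ 2 * level q x n.
    rewrite /level (@eq_ipq _ _ _ n y ((f n)%:C *: x) y ((f n)%:C *: x)); last 2 first.
    - by move=> v; rewrite /y size_tuple.
    - by move=> v; rewrite /y size_tuple.
    rewrite ipqZl ipqZr conjC_real; case: (ipq q n x x) => a b /=; ring.
  rewrite ler_wpM2r ?level_ge0 // -[f n ^+ 2]real_normK ?num_real //.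
  rewrite ler_sqr ?nnegrE ?exprn_ge0 //; apply: (le_trans (hf n)).
  by apply: ler_wiXn2l.
have sr n : series (level q y) n <= (rho ^+ M) ^+ 2 * nsq q x.
  apply: (@le_trans _ _ ((rho ^+ M) ^+ 2 * series (level q x) n)).
    by rewrite /series /= mulr_sumr; apply: ler_sum => k _; exact: lev.
  by rewrite ler_wpM2l ?sqr_ge0 // series_le_nsq.
have [fy ly] := fock_bounded hq sr; split=> //.
rewrite -ler_sqr ?nnegrE ?mulr_ge0 ?exprn_ge0 ?fnorm_ge0 //.
by rewrite exprMn !(fnorm_sq hq).
Qed.

Section Decay.
Variable rho : R.
Hypotheses (rho0 : 0 < rho) (rho1 : rho <= 1) (q_rho : `|q| <= rho).
Let rho_ge0 := ltW rho0.

Lemma band_decay_qN : band_decay rho (@qN R d q).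
Proof.
split; last by exists 0%N => M x h w; rewrite subn0 => wM; rewrite /qN h ?mulr0.
split; first exact: qND.
exists 1 => // M x fx xM; rewrite mul1r.
apply: (@diag_low (fun n => q ^+ n)) => // n.
by rewrite normrX lerXn2r ?nnegrE // normr_ge0.
Qed.

Local Notation num := (@numberop R d).

Lemma num_lin : lin num.
Proof.
move=> c x y; apply/funext => w.
by rewrite !(vecDE, vecZE) /numberop !(vecDE, vecZE); ring.
Qed.

Lemma num_cr i x : num (cr i x) = cr i (num x) + cr i x.
Proof.
apply/funext => -[|j w]; rewrite vecDE /numberop; first by rewrite /cr /= mulr0 addr0.
by rewrite !cr_cons /= -natr1; ring.
Qed.

Lemma num_an i x : num (an q i x) = an q i (num x) - an q i x.
Proof.
apply/funext => w; rewrite vecDE vecNE /numberop /an mulr_sumr -sumrN -big_split.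
by apply: eq_bigr => k _ /=; rewrite size_ins -natr1; ring.
Qed.

(* The double commutator [[num, a], b]; it is the expression in [Psi] when a is a
   left and b a right multiplication. *)
Definition dcomm (a b : oper) : oper :=
  fun x => num (a (b x)) - a (num (b x)) - b (num (a x)) + b (a (num x)).

(* [[num, gen i] = cr i - an i], and its commutator with [rgen j] only involves
   [[cr i, ran j]] and [[an i, rcr j]], which are multiples of q ^ num. *)
Lemma dcomm_gen i j x : dcomm (gen q i) (rgen q j) x = - (2 * (i == j)%:R) *: qN q x.
Proof.
have genN y : num (gen q i y) - gen q i (num y) = cr i y - an q i y.
  rewrite !genE (linD num_lin) num_cr num_an.
  by apply/funext => w; rewrite !(vecDE, vecNE); ring.
have lr := band_lin (band_rgen hq j).
have -> : dcomm (gen q i) (rgen q j) x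
    = (num (gen q i (rgen q j x)) - gen q i (num (rgen q j x)))
      - rgen q j (num (gen q i x) - gen q i (num x)).
  rewrite (linB lr) /dcomm.
  by apply/funext => w; rewrite !(vecDE, vecNE); ring.
rewrite !genN (linB lr) !rgenE (linD (@crD _ _ i)) (linD (@anD _ _ q i)).
rewrite cr_rcr (cr_ran q) an_rcr (an_ran hq).
by apply/funext => w; rewrite !(vecDE, vecNE, vecZE); ring.
Qed.

Lemma dcomm_gen_decay i b : poly (@rgen R d q) b ->
  band_decay rho (dcomm (gen q i) b).
Proof.
have lg := band_lin (band_gen hq i).
elim=> {b} [j||b b' hb h hb' h'|c b hb h|b b' hb h hb' h'].
- apply: (@eq_band_decay _ (- (2 * (i == j)%:R) *: (@qN R d q))).
    by move=> x; rewrite dcomm_gen.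
  by apply: band_decay_scale; exact: band_decay_qN.
- apply: (@eq_band_decay _ (fun=> 0)); last exact: band_decay0.
  move=> x; rewrite /dcomm /=.
  by apply/funext => w; rewrite !(vecDE, vecNE); ring.
- apply: eq_band_decay (band_decay_add rho_ge0 h h') => x.
  rewrite -[LHS]/(dcomm _ b x + dcomm _ b' x) /dcomm.
  have E y : (b + b') y = b y + b' y by [].
  rewrite !E (linD lg) !(linD num_lin) (linD lg).
  by apply/funext => w; rewrite !(vecDE, vecNE); ring.
- apply: eq_band_decay (band_decay_scale c h) => x.
  rewrite -[LHS]/(c *: dcomm _ b x) /dcomm.
  have E y : (c *: b) y = c *: b y by [].
  rewrite !E (linZ lg) !(linZ num_lin) (linZ lg).
  by apply/funext => w; rewrite !(vecDE, vecNE, vecZE); ring.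
- have Bb := poly_rgen_band hq hb; have Bb' := poly_rgen_band hq hb'.
  have Db := band_decay_comp_r rho0 rho1 h Bb'.
  have Db' := band_decay_comp_l Bb h'.
  apply: eq_band_decay (band_decay_add rho_ge0 Db Db') => x.
  rewrite -[LHS]/(dcomm _ b (b' x) + b (dcomm _ b' x)) /dcomm /=.
  have lb := band_lin Bb; rewrite (linD lb) !(linB lb).
  by apply/funext => w; rewrite !(vecDE, vecNE); ring.
Qed.

Lemma dcomm_decay a b : poly (@gen R d q) a -> poly (@rgen R d q) b ->
  band_decay rho (dcomm a b).
Proof.
move=> ha hb; have Bb := poly_rgen_band hq hb; have lb := band_lin Bb.
elim: ha => {a} [i||a a' ha h ha' h'|c a ha h|a a' ha h ha' h'].
- exact: dcomm_gen_decay.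
- apply: (@eq_band_decay _ (fun=> 0)); last exact: band_decay0.
  move=> x; rewrite /dcomm /=.
  by apply/funext => w; rewrite !(vecDE, vecNE); ring.
- apply: eq_band_decay (band_decay_add rho_ge0 h h') => x.
  rewrite -[LHS]/(dcomm a b x + dcomm a' b x) /dcomm.
  have E y : (a + a') y = a y + a' y by [].
  rewrite !E !(linD num_lin) !(linD lb).
  by apply/funext => w; rewrite !(vecDE, vecNE); ring.
- apply: eq_band_decay (band_decay_scale c h) => x.
  rewrite -[LHS]/(c *: dcomm a b x) /dcomm.
  have E y : (c *: a) y = c *: a y by [].
  rewrite !E !(linZ num_lin) !(linZ lb).
  by apply/funext => w; rewrite !(vecDE, vecNE, vecZE); ring.
- have Ba := poly_gen_band hq ha; have Ba' := poly_gen_band hq ha'.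
  have Da := band_decay_comp_r rho0 rho1 h Ba'.
  have Da' := band_decay_comp_l Ba h'.
  apply: eq_band_decay (band_decay_add rho_ge0 Da Da') => x.
  rewrite -[LHS]/(dcomm a b (a' x) + a (dcomm a' b x)) /dcomm /=.
  have la := band_lin Ba; rewrite (linD la) !(linB la).
  (* The Leibniz rule in [a] holds because [b] commutes with [a] and [a']: the mixed terms then
     cancel. *)
  rewrite -!(poly_comm hq _ ha hb) -!(poly_comm hq _ ha' hb).
  by apply/funext => w; rewrite !(vecDE, vecNE); ring.
Qed.

(** On degree at least [M] the image has degree at least [M - K], so $e^{-tN}$ gains $e^{-tM}$ up to
    the constant $e^{tK}$. *)
Lemma ou_band_decay (t : R) T : 0 <= t -> band_decay rho T ->
  decay q (rho * expR (- t)) (@ou_fock R d t \o T).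
Proof.
move=> t0 [[TD [C C0 TC]] [K TK]].
have e0 : 0 < expR (- t) by exact: expR_gt0.
have e1 : expR (- t) <= 1 by rewrite -expR0 ler_expR oppr_le0.
split.
  apply: lin_comp => // c x y; apply/funext => w.
  by rewrite !(vecDE, vecZE) /ou_fock !(vecDE, vecZE); ring.
exists (C * expR (- t) ^- K) => [|M x fx xM].
  by rewrite mulr_ge0 // invr_ge0 exprn_ge0 // ltW.
have [fT h] := TC M x fx xM.
have sym n : `|expR (- t * n%:R)| <= expR (- t) ^+ n.
  by rewrite ger0_norm ?expR_ge0 // mulrC expRM_natl.
have [fO hO] :=
  @diag_low (fun n => expR (- t * n%:R)) _ _ _ (ltW e0) e1 sym fT (TK _ _ xM).
split; first exact: fO.
apply: (le_trans hO); rewrite exprMn.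
apply: (@le_trans _ _
  ((expR (- t) ^- K * expR (- t) ^+ M) * (C * rho ^+ M * fnorm q x))).
  apply: ler_pM; [by rewrite exprn_ge0 // ltW | exact: fnorm_ge0 | | exact: h].
  exact: expr_subn_le.
by rewrite le_eqVlt; apply/orP; left; apply/eqP; ring.
Qed.

End Decay.
End Commutators.

(** * The q-Gaussian algebra *)

Section Adjoints.
Variables (R : realType) (d : nat) (q : R) (hq : -1 < q < 1).
Local Notation vec := (vec R d).
Local Notation oper := (oper R d).
Implicit Types (x y z : vec) (S T : oper).

(** Creation raises the level by one, so the two series of inner products in [fip_cr] are shifts of
    each other. *)
Lemma lim_series_shift (u v : R ^nat) : u 0%N = 0 -> (forall n, u n.+1 = v n) ->
  cvgn (series v) -> limn (series u) = limn (series v).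
Proof.
move=> u0 uS cv; apply: cvg_lim => //; rewrite -cvg_shiftS.
suff -> : [sequence series u n.+1]_n = series v by exact: cv.
apply/funext => n; rewrite /series /= big_nat_recl // u0 add0r.
by apply: eq_bigr => k _; rewrite uS.
Qed.

Lemma fip_cr i x y : fock q x -> fock q y -> fip q (cr i x) y = fip q x (an q i y).
Proof.
move=> fx fy; have [_ [C _ anC] _ _] := band_an hq i; have [fa _] := anC y fy.
rewrite /fip; congr (_ +i* _); apply: lim_series_shift.
- by rewrite ipq0_cr.
- by move=> n; rewrite ipq_cr.
- exact: (cvg_ipq_Re hq).
- by rewrite ipq0_cr.
- by move=> n; rewrite ipq_cr.
- exact: (cvg_ipq_Im hq).
Qed.

Lemma fipDr (c : R[i]) x y z : fock q x -> fock q y -> fock q z ->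
  fip q z (c *: x + y) = c^* * fip q z x + fip q z y.
Proof.
move=> fx fy fz; rewrite (fipC hq (fockDZ hq fx fy) fz) (fipDl hq) //.
by rewrite rmorphD rmorphM /= -!(fipC hq).
Qed.

Lemma band_fock T x : band q T -> fock q x -> fock q (T x).
Proof. by move=> [_ [C _ TC] _ _] /TC []. Qed.

Lemma adjoint_sum (I : Type) (r : seq I) (c : I -> R) (S T : I -> oper) :
  (forall i, band q (S i)) -> (forall i, band q (T i)) ->
  (forall i, is_adjoint q (S i) (T i)) ->
  is_adjoint q (\sum_(i <- r) (c i)%:C *: S i) (\sum_(i <- r) (c i)%:C *: T i).
Proof.
move=> bS bT adj x y fx fy.
have sumE (U : I -> oper) z : (\sum_(i <- r) (c i)%:C *: U i) z
    = \sum_(i <- r) (c i)%:C *: U i z.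
  by rewrite (big_morph (fun S : oper => S z) (id1 := 0) (op1 := +%R)).
rewrite !sumE; elim: r {sumE} => [|i r IHr].
  rewrite !big_nil; have := fipDl hq (-1) (fock0 hq) (fock0 hq) fy.
  rewrite scaler0 addr0 mulN1r addNr => ->.
  have := fipDr (-1) (fock0 hq) (fock0 hq) fx.
  by rewrite scaler0 addr0 rmorphN1 mulN1r addNr => ->.
have fsum (U : I -> oper) z : (forall i, band q (U i)) -> fock q z ->
    fock q (\sum_(j <- r) (c j)%:C *: U j z).
  move=> bU fz; elim: r {IHr} => [|j r IHr].
    by rewrite big_nil; exact: (fock0 hq).
  by rewrite big_cons; apply: (fockDZ hq) => //; exact: band_fock.
rewrite !big_cons (fipDl hq) //; [|exact: band_fock|exact: fsum].
rewrite fipDr //; [|exact: band_fock|exact: fsum].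
by rewrite IHr adj // conjC_real.
Qed.

Lemma gen_adjoint (i : 'I_d) : is_adjoint q (gen q i) (gen q i).
Proof.
move=> x y fx fy; have fc z := band_fock (band_cr hq i) (x := z).
have fa z := band_fock (band_an hq i) (x := z).
rewrite !genE -[cr i x]scale1r -[cr i y]scale1r (fipDl hq) ?fipDr; try by auto.
rewrite rmorph1 !mul1r fip_cr // addrC; congr (_ + _).
rewrite (fipC hq fy (fa _ fx)) -fip_cr // -(fipC hq (fc _ fy) fx) //.
Qed.

(** Settles the star clause of [Aq]. *)
Lemma poly_adjoint a : poly (@gen R d q) a ->
  exists2 a', poly (@gen R d q) a' & is_adjoint q a a'.
Proof.
have pb (b : oper) : poly (@gen R d q) b -> band q b by exact: poly_gen_band.
elim=> {a} [i||a b ha [a' ha' aa'] hb [b' hb' bb']|c a ha [a' ha' aa']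
           |a b ha [a' ha' aa'] hb [b' hb' bb']].
- by exists (gen q i); [exact: poly_gen | exact: gen_adjoint].
- by exists id; [exact: poly_one | move=> x y].
- exists (a' + b'); first exact: poly_add.
  move=> x y fx fy; rewrite -[(a + b) x]/(a x + b x) -[(a' + b') y]/(a' y + b' y).
  rewrite -[a x]scale1r -[a' y]scale1r (fipDl hq) ?fipDr //;
    do ?by apply: band_fock => //; exact: pb.
  by rewrite rmorph1 aa' // bb'.
- exists (c^* *: a'); first exact: poly_scale.
  move=> x y fx fy; rewrite -[(c *: a) x]/(c *: a x) -[(_ *: a') y]/(c^* *: a' y).
  rewrite -[c *: a x]addr0 -[_ *: a' y]addr0.
  have fax := band_fock (pb _ ha) fx; have fay := band_fock (pb _ ha') fy.
  rewrite (fipDl hq) ?fipDr //; do ?exact: (fock0 hq).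
  rewrite conjCK aa' //; congr (_ + _).
  have := fipDl hq (-1) (fock0 hq) (fock0 hq) fy.
  rewrite scaler0 addr0 mulN1r addNr => ->.
  have := fipDr (-1) (fock0 hq) (fock0 hq) fx.
  by rewrite scaler0 addr0 rmorphN1 mulN1r addNr => ->.
- exists (b' \o a'); first exact: poly_mul.
  move=> x y fx fy; rewrite /= aa' ?bb' //; first exact: (band_fock (pb _ ha')).
  exact: (band_fock (pb _ hb)).
Qed.

Lemma band_bounded_op T : band q T -> bounded_op q T.
Proof.
move=> [TD [C _ TC] _ _]; split=> [x /TC []//|c x y _ _|]; first exact: TD.
by exists C => x /TC [].
Qed.

End Adjoints.

Section QGaussianAlgebra.
Variables (R : realType) (HR : vectType R) (ip : {dot HR for idfun}).
Variables (e : 'I_(\dim {:HR}) -> HR) (q : R).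
Hypotheses (he : orthonormal_basis ip e) (hq : -1 < q < 1).
Local Notation d := (\dim {:HR}).
Local Notation vec := (vec R d).
Local Notation oper := (oper R d).
Local Notation Omega := (@vacuum R d).
Local Notation A_q := (Aq ip e q).
Local Notation lpoly := (poly (@gen R d q)).
Local Notation rpoly := (poly (@rgen R d q)).

Lemma creation_complexify xi :
  creation (complexify ip e xi) = \sum_i (ip xi (e i))%:C *: cr i.
Proof.
apply/funext => x.
rewrite (big_morph (fun S : oper => S x) (id1 := 0) (op1 := +%R)) //.
apply/funext => w; rewrite (big_morph (fun y : vec => y w) (id1 := 0) (op1 := +%R)) //.
case: w => [|j w]; first by rewrite big1 // => i _; rewrite -[LHS]/(_ * 0) mulr0.
rewrite (bigD1 j) //= big1 ?addr0 => [|i ij].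
  by rewrite -[RHS]/(_ * cr j x (j :: w)) cr_cons eqxx mul1r.
by rewrite -[LHS]/(_ * cr i x (j :: w)) cr_cons eq_sym (negPf ij) mul0r mulr0.
Qed.

Lemma creation_basis i : creation (complexify ip e (e i)) = cr i.
Proof.
rewrite creation_complexify (bigD1 i) //= he eqxx scale1r big1 ?addr0 // => j ij.
by rewrite he eq_sym (negPf ij) scale0r.
Qed.

Lemma poly_Aq a : lpoly a -> A_q a.
Proof.
elim=> {a} [i||a b _ ha _ hb|c a _ ha|a b _ ha _ hb].
- rewrite /gen -(creation_basis i); apply: Aq_gen.
    by apply: band_bounded_op; exact: (band_an hq).
  by rewrite creation_basis => x y; exact: (fip_cr hq).
- exact: Aq_one.
- exact: Aq_add.
- exact: Aq_scale.
- exact: Aq_mul.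
Qed.

(** The adjoints occurring in [Aq] are arbitrary operators fixed by a relation on [fock], so
    agreement on [fock] is the right notion; it follows from uniqueness of adjoints. *)
Lemma Aq_poly a : A_q a -> exists2 a0, lpoly a0 & forall x, fock q x -> a x = a0 x.
Proof.
have pf b x : lpoly b -> fock q x -> fock q (b x).
  by move=> pb; apply: band_fock; exact: (poly_gen_band hq).
elim=> {a} [xi l' bl' al'||a b _ [a' pa ha] _ [b' pb hb]|c a _ [a' pa ha]
   |a b _ [a' pa ha] _ [b' pb hb]|a a' _ [a0 pa ha] ba' aa'].
- pose c i := ip xi (e i).
  have sumE (U : 'I_d -> oper) z :
      (\sum_i (c i)%:C *: U i) z = \sum_i (c i)%:C *: U i z.
    by rewrite (big_morph (fun S : oper => S z) (id1 := 0) (op1 := +%R)).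
  exists (\sum_i (c i)%:C *: gen q i).
    by apply: poly_sum => i; apply: poly_scale; exact: poly_gen.
  move=> x fx; rewrite -[LHS]/(creation _ x + l' x) creation_complexify -/c.
  have fan z : fock q z -> fock q ((\sum_i (c i)%:C *: an q i) z).
    move=> fz; rewrite sumE; elim/big_ind: _ => [|y y' fy fy'|i _].
    - exact: (fock0 hq).
    - exact: (fockD hq).
    - by apply: (fockZ hq); exact: (band_fock (band_an hq i)).
  have -> : l' x = (\sum_i (c i)%:C *: an q i) x.
    apply: (fip_right_inj hq); [by case: bl' => + _ _; apply | exact: fan|].
    move=> z fz; rewrite -al' // creation_complexify.
    apply: (adjoint_sum hq) => // [i|i|i]; [exact: (band_cr hq)|exact: (band_an hq)|].
    by move=> y y'; exact: (fip_cr hq).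
  rewrite !sumE -big_split; apply: eq_bigr => i _ /=.
  by rewrite -scalerDr.
- by exists id; first exact: poly_one.
- exists (a' + b'); first exact: poly_add.
  by move=> x fx; rewrite -[LHS]/(a x + b x) ha // hb.
- exists (c *: a'); first exact: poly_scale.
  by move=> x fx; rewrite -[LHS]/(c *: a x) ha.
- exists (a' \o b'); first exact: poly_mul.
  by move=> x fx; rewrite /= hb // ha //; exact: pf.
- have [a1 pa1 aa1] := poly_adjoint hq pa.
  exists a1 => // x fx; apply: (fip_right_inj hq); [|exact: pf|].
    by case: ba' => + _ _; apply.
  by move=> z fz; rewrite -aa' // ha // aa1.
Qed.

Lemma rpoly_commutant b : rpoly b -> commutant q A_q b.
Proof.
move=> pb; have bb := poly_rgen_band hq pb; split; first exact: band_bounded_op.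
move=> S /Aq_poly[a pa ha] x fx.
by rewrite !ha //; [rewrite (poly_comm hq _ pa pb) | exact: (band_fock bb)].
Qed.

Lemma poly_Gammaq a : lpoly a -> Gammaq ip e q a.
Proof.
move=> pa; split; first by apply: band_bounded_op; exact: (poly_gen_band hq).
by move=> S [_ hS] x fx; rewrite hS //; exact: poly_Aq.
Qed.

Lemma fin_trunc M (x : vec) : fin (trunc M x).
Proof. by exists M => w Mw; rewrite /trunc ltnNge Mw. Qed.

Lemma fin_vacuum : fin Omega.
Proof. by exists 1%N => -[]. Qed.

Lemma fin_fock (x : vec) : fin x -> fock q x.
Proof.
move=> [M xM]; have -> : x = trunc M x; last exact: (proj1 (trunc_fock hq M x)).
by apply/funext => w; rewrite /trunc; case: ltnP => // /xM.
Qed.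

(** The vacuum is separating: each finite vector is $b\Omega$ with [b] a right polynomial, and
    $Tb\Omega=bT\Omega=ba\Omega=ab\Omega$. Boundedness and density of finite vectors extend the
    equality to [fock]. *)
Lemma Gammaq_eq_poly T a : Gammaq ip e q T -> lpoly a -> T Omega = a Omega ->
  forall x, fock q x -> T x = a x.
Proof.
move=> [[Tf TD [M TM]] Tc] pa TO.
have ba := poly_gen_band hq pa; have [aD [C C0 aC] _ _] := ba.
have Tfin x : fin x -> T x = a x.
  move=> /(fin_rpoly_vacuum hq)[b [pb <-]].
  have fO : fock q Omega by apply: fin_fock; exact: fin_vacuum.
  by rewrite Tc ?TO //; [rewrite (poly_comm hq _ pa pb) | exact: rpoly_commutant].
move=> x fx; have fa := band_fock ba fx; have fT := Tf x fx.
apply/eqP; rewrite -subr_eq0; apply/eqP; apply: (fnorm_eq0 hq); first exact: (fockB hq).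
apply/le_anti; rewrite fnorm_ge0 andbT; apply/ler_addgt0Pl => eps eps0; rewrite addr0.
(* The bound [M] of [bounded_op] carries no sign, hence the absolute value; adding 1 makes the
   denominator positive. *)
have K0 : 0 < `|M| + C + 1 by rewrite -addrA ltr_wpDl // ltr_wpDl.
have de : 0 < eps / (`|M| + C + 1) by rewrite divr_gt0.
have := sub_trunc_cvg0 hq fx => /cvgr0Pnorm_lt /(_ _ de) [N _ /(_ N (leqnn N)) /=].
rewrite ger0_norm ?fnorm_ge0 //; set t := trunc N x => ht.
have ft : fock q t by apply: fin_fock; exact: fin_trunc.
have fxt : fock q (x - t) by exact: (fockB hq).
have xE : x = 1 *: (x - t) + t by rewrite scale1r subrK.
have -> : T x - a x = T (x - t) - a (x - t).
  have TE : T x = T (x - t) + T t by rewrite {1}xE TD // scale1r.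
  have aE : a x = a (x - t) + a t by rewrite {1}xE aD scale1r.
  rewrite TE aE (Tfin t); last exact: fin_trunc.
  by rewrite opprD addrACA subrr addr0.
apply: (le_trans (fnormB hq (Tf _ fxt) (band_fock ba fxt))).
apply: (@le_trans _ _ ((`|M| + C) * fnorm q (x - t))).
  rewrite mulrDl lerD //; last exact: (proj2 (aC _ fxt)).
  by apply: (le_trans (TM _ fxt)); rewrite ler_wpM2r ?fnorm_ge0 // ler_norm.
move: ht; rewrite ltr_pdivlMr // => /ltW; apply: le_trans; rewrite mulrC.
by rewrite ler_wpM2l ?fnorm_ge0 // lerDl.
Qed.

(** The polynomial [a] inhabits the set in [Wq], so the default of [xget] is not taken; the
    separating property identifies the chosen operator. *)
Lemma Wq_poly a (y : vec) : lpoly a -> a Omega = y ->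
  Wq ip e q y Omega = y /\ forall x, fock q x -> Wq ip e q y x = a x.
Proof.
move=> pa aO; have [GW WO] : Gammaq ip e q (Wq ip e q y) /\ Wq ip e q y Omega = y.
  apply: (xgetPex 0 (P := [set T | Gammaq ip e q T /\ T Omega = y])).
  by exists a; split=> //; exact: poly_Gammaq.
by split=> //; apply: (Gammaq_eq_poly GW pa); rewrite WO aO.
Qed.

Lemma Wq_vacuum (y : vec) : fin y -> Wq ip e q y Omega = y.
Proof. by move=> /(fin_poly_vacuum q)[a [pa aO]]; exact: (proj1 (Wq_poly pa aO)). Qed.

(** Products of left operators on the vacuum become right actions:
    $W_q(y)b\Omega=bW_q(y)\Omega=by$. *)
Lemma Wq_rpoly (y : vec) b : fin y -> rpoly b ->
  Wq ip e q y (b Omega) = b y.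
Proof.
move=> /(fin_poly_vacuum q)[a [pa aO]] pb; have [_ ->] := Wq_poly pa aO.
  by rewrite (poly_comm hq _ pa pb) aO.
by apply: fin_fock; apply: (band_fin (poly_rgen_band hq pb)); exact: fin_vacuum.
Qed.

Lemma fin_num (x : vec) : fin x -> fin (numberop x).
Proof. by move=> [M xM]; exists M => w wM; rewrite /numberop xM ?mulr0. Qed.

Lemma fin_ou (t : R) (x : vec) : fin x -> fin (ou_fock t x).
Proof. by move=> [M xM]; exists M => w wM; rewrite /ou_fock xM ?mulr0. Qed.

(** The rightmost factor meets the vacuum first, so [b] may be replaced by the right polynomial [b0]
    and moved to the left past [x], [a] and the values of [Delta]. The four terms of [Psi] become
    those of [dcomm] at $x\Omega$. *)
Lemma Psi_vacuum (t : R) a b x a0 b0 : A_q x ->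
  lpoly a0 -> (forall y, fock q y -> a y = a0 y) ->
  rpoly b0 -> b0 Omega = b Omega ->
  Psi ip e q t a b x Omega = - 2^-1 *: ou_fock t (dcomm a0 b0 (x Omega)).
Proof.
move=> Ax pa ha pb hb.
have [x0 px hx] := Aq_poly Ax.
have ba := poly_gen_band hq pa; have bb := poly_rgen_band hq pb.
have bx := poly_gen_band hq px.
have fO : fin Omega := fin_vacuum.
have fy : fin (x Omega) by rewrite hx; [exact: (band_fin bx) | exact: fin_fock].
have fbO : fin (b Omega) by rewrite -hb; exact: (band_fin bb).
set y := x Omega in fy *.
have xb : x (b Omega) = b0 y.
  rewrite hx; last exact: fin_fock.
  by rewrite -hb (poly_comm hq _ px pb) /y hx //; exact: fin_fock.
have fb0y : fin (b0 y) by exact: (band_fin bb).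
have E1 : a (x (b Omega)) = a0 (b0 y) by rewrite xb ha //; exact: fin_fock.
have E2 : Delta ip e q x (b Omega) = b0 (numberop y).
  by rewrite /Delta -hb Wq_rpoly //; exact: fin_num.
have E3 : Delta ip e q (a \o x) (b Omega) = b0 (numberop (a0 y)).
  have E0 : (a \o x) Omega = a0 y by rewrite /= ha //; exact: fin_fock.
  by rewrite /Delta E0 -hb Wq_rpoly //; apply: fin_num; exact: (band_fin ba).
rewrite /Psi.
set Z := (X in Phi ip e q t X).
have -> : (- 2^-1 *: Phi ip e q t Z) Omega = - 2^-1 *: Phi ip e q t Z Omega by [].
have ZO : Z Omega = dcomm a0 b0 y.
  have -> : Z Omega = Delta ip e q (a \o x \o b) Omega + a (Delta ip e q x (b Omega))
      - Delta ip e q (a \o x) (b Omega) - a (Delta ip e q (x \o b) Omega) by [].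
  rewrite E2 E3 /Delta /= E1 xb !Wq_vacuum; do ?exact: fin_num.
    rewrite !ha; do ?[apply: fin_fock; apply: fin_num => //
                     |apply: fin_fock; apply: (band_fin bb); exact: fin_num].
    rewrite /dcomm (poly_comm hq (numberop y) pa pb).
    by apply/funext => w; rewrite !(vecDE, vecNE); ring.
  by apply: fin_num; exact: (band_fin ba).
rewrite /Phi ZO Wq_vacuum //; apply: fin_ou.
have fN (z : vec) : fin z -> fin (- z) by rewrite -scaleN1r; exact: fin_scale.
have fA z : fin z -> fin (a0 z) by exact: (band_fin ba).
have fB z : fin z -> fin (b0 z) by exact: (band_fin bb).
have fM := fin_num.
by rewrite /dcomm; do ![apply: fin_add]; do ?[apply: fN]; auto.
Qed.

End QGaussianAlgebra.

(** * The critical radius and the conclusion *)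

(** For finite [p] the witness is $\max(d,1)^{-1/p}$. It equals [dim_root] unless [d = 0], where
    [dim_root] is infinite, the witness is 1 and [x < 1] does the work. *)
Lemma critical_radius (R : realType) (HR : vectType R) (p : \bar R) :
  (1 <= p)%E -> exists D : R, [/\ 0 < D <= 1,
    forall x : R, x < 1 -> (x%:E < dim_root HR p)%E -> x < D,
    forall x : R, x < 1 -> (x%:E <= dim_root HR p)%E -> x <= D &
    forall rho : R, 0 <= rho -> rho < D ->
      forall r, p = r%:E -> (maxn (\dim {:HR}) 1)%:R * rho `^ r < 1].
Proof.
rewrite /dim_root; set d := \dim {:HR}.
case: p => [r|_|//]; last first.
  exists 1; have -> : ((d%:R `^ fine (+oo^-1)%E)%:E^-1)%E = 1%E :> \bar R.
    by rewrite invey /= powRr0 inve1.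
  by split=> //; rewrite ?ltr01 ?lexx.
rewrite lee_fin => r1; have r0 : 0 < r by rewrite (lt_le_trans ltr01).
pose delta : R := (maxn d 1)%:R.
have delta1 : 1 <= delta by rewrite ler1n leq_max orbT.
have delta0 : 0 < delta by rewrite (lt_le_trans ltr01).
exists ((delta `^ r^-1)^-1).
have pd : 0 < delta `^ r^-1 by rewrite powR_gt0.
have pd1 : 1 <= delta `^ r^-1.
  by rewrite -[leLHS](powRr0 delta) ler_powR // invr_ge0 ltW.
have root_eq : (0 < d)%N ->
    ((d%:R `^ fine (r%:E^-1))%:E^-1)%E = ((delta `^ r^-1)^-1)%:E :> \bar R.
  move=> d0; have dE : delta = d%:R by rewrite /delta (maxn_idPl d0).
  rewrite inver gt_eqF //= -dE inver gt_eqF //.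
have root1 : d = 0%N -> (delta `^ r^-1)^-1 = 1.
  by move=> dE; rewrite /delta dE powR1 invr1.
split.
- by rewrite invr_gt0 pd /= invf_le1.
- move=> x x1; have [/root1 -> //|d0] := posnP d.
  by rewrite root_eq.
- move=> x x1; have [/root1 -> _|d0] := posnP d; first exact: ltW.
  by rewrite root_eq.
move=> rho rho0 rhoD _ [<-]; rewrite -/delta.
have : rho `^ r < (delta `^ r^-1)^-1 `^ r.
  by apply: gt0_ltr_powR; rewrite // ?nnegrE // invr_ge0 ltW.
have -> : (delta `^ r^-1)^-1 `^ r = delta^-1.
  rewrite -powR_inv1 ?(ltW pd) // -!powRrM.
  have -> : r^-1 * (-1 * r) = -1 by field; rewrite gt_eqF.
  by rewrite powR_inv1 // ltW.
by rewrite -ltr_pdivlMl // mulr1.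
Qed.

Section Gradient.
Variables (R : realType) (HR : vectType R) (ip : {dot HR for idfun}).
Variables (e : 'I_(\dim {:HR}) -> HR) (q : R).
Hypotheses (he : orthonormal_basis ip e) (hq : -1 < q < 1).
Local Notation d := (\dim {:HR}).

(** [rho] is the decay rate of the double commutator and $e^{-t}$ the gain from the semi-group; only
    their product has to be subcritical. *)
Lemma Psi_extends (p : \bar R) (rho t : R) a b :
  (1 <= p)%E -> 0 < rho -> rho <= 1 -> `|q| <= rho -> 0 <= t ->
  rho * expR (- t) < 1 ->
  (forall r, p = r%:E -> (maxn d 1)%:R * (rho * expR (- t)) `^ r < 1) ->
  Aq ip e q a -> Aq ip e q b -> extends_in_schatten ip e q p (Psi ip e q t a b).
Proof.
move=> p1 rho0 rho1 q_rho t0 rt1 hp Aa Ab.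
have [a0 pa ha] := Aq_poly hq Aa; have [b' pb' hb'] := Aq_poly hq Ab.
have fO := fin_vacuum HR.
have fb : fin (b (@vacuum R d)).
  rewrite hb'; last exact: (fin_fock hq fO).
  by apply: (band_fin (poly_gen_band hq pb')).
have [b0 [pb hb]] := fin_rpoly_vacuum hq fb.
have D := band_decay_scale hq (- 2^-1) (dcomm_decay hq rho0 rho1 q_rho pa pb).
exists (@ou_fock R d t \o ((- 2^-1 : R[i]) *: dcomm a0 b0)); split.
  apply: (@schatten_of_decay _ _ _ hq (rho * expR (- t))) => //.
    by rewrite mulr_ge0 ?expR_ge0 // ltW.
  exact: (ou_band_decay hq t0 D).
move=> x Ax; rewrite (Psi_vacuum he hq t Ax pa ha pb hb).
apply/funext => w; rewrite vecZE /ou_fock /=.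
rewrite -[(_ *: dcomm a0 b0) _ w]/(_ * dcomm a0 b0 _ w) mulrCA.
by [].
Qed.

End Gradient.

Theorem theorem4p14 (R : realType) (HR : vectType R) (ip : {dot HR for idfun})
    (e : 'I_(\dim {:HR}) -> HR) (he : orthonormal_basis ip e)
    (q : R) (hq : -1 < q < 1) (p : \bar R) (hp : (1 <= p)%E) :
  ((`|q|%:E < dim_root HR p)%E -> gradient_S ip e q p) /\
  ((`|q|%:E <= dim_root HR p)%E -> immediately_gradient_S ip e q p).
Proof.
have [D [/andP[D0 D1] hlt hle hD]] := critical_radius HR hp.
have q1 : `|q| < 1 by rewrite ltr_norml.
split=> [/(hlt _ q1) qD|/(hle _ q1) qD] a b Aa Ab.
  have q0 := normr_ge0 q.
  (* The midpoint is at least $|q|$, strictly below [D], and positive even when [q = 0]. *)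
  apply: (@Psi_extends _ _ ip e q he hq p ((`|q| + D) / 2)) => //; try lra.
    by rewrite oppr0 expR0; lra.
  by rewrite oppr0 expR0 mulr1; apply: hD; lra.
move=> t t0.
have e1 : expR (- t) < 1 by rewrite -expR0 ltr_expR oppr_lt0.
have De : D * expR (- t) < D by rewrite gtr_pMr.
(* Here $|q|$ may equal [D]; the factor $e^{-t}<1$ restores the strict inequality. *)
apply: (@Psi_extends _ _ ip e q he hq p D) => //; first exact: ltW.
  exact: lt_le_trans De D1.
by apply: hD => //; rewrite mulr_ge0 ?expR_ge0 // ltW.
Qed.
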